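(* Assume that $r\geq 3$, $m\geq 2$ and $1\leq t\leq m$. Let $c>1$ and let $k,\ell$ be integers with $1\le k\le m-1$, $0\le\ell\le k$, $0\le\ell\le t$ and $t-\ell\le m-k$. Let $$M^m_t=\mathbb{S}^k_\ell(c)\times\mathbb{S}^{m-k}_{t-\ell}\left(\tfrac{c}{c-1}\right)=\Big\{x\in\mathbb{S}^{m+1}_t:\ -\sum_{i=1}^{\ell}x_i^2+\sum_{i=t+1}^{t+k-\ell+1}x_i^2=\tfrac1c,\ \ -\sum_{i=\ell+1}^{t}x_i^2+\sum_{i=t+k-\ell+2}^{m+2}x_i^2=\tfrac{c-1}{c}\Big\}$$ be a generalised pseudo-Clifford torus in $\mathbb{S}^{m+1}_t\subset\mathbb{R}^{m+2}_t$. Then $M^m_t$ is proper $r$-harmonic if and only if $c\neq\frac mk$ and $$P_3(c)=k\,c^3-k(r+2)\,c^2+[m(r-1)+k(r+2)]\,c-m\,r=0 .$$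
   Context: $\mathbb{R}^n_t$ is $\mathbb{R}^n$ with $\langle x,y\rangle=-\sum_{i=1}^t x_iy_i+\sum_{i=t+1}^n x_iy_i$. $\mathbb{S}^n_t(c)=\{x\in\mathbb{R}^{n+1}_t:\langle x,x\rangle=1/c\}$ for $c>0$, with the induced metric (index $t$, constant sectional curvature $c$), and $\mathbb{S}^n_t=\mathbb{S}^n_t(1)$. All manifolds are connected (a connected component is chosen if necessary). The curvature convention on $\mathbb{S}^n_t(c)$ is $R(X,Y)Z=c(\langle Y,Z\rangle X-\langle X,Z\rangle Y)$. Hypersurfaces. For a hypersurface $\varphi:M\to N$ with nondegenerate induced metric, unit normal $\eta$, $\varepsilon=\langle\eta,\eta\rangle=\pm1$ and shape operator $A(X)=-\nabla^N_X\eta$, the mean curvature function is $f=\frac1m\varepsilon\operatorname{Tr}A$; the hypersurface is minimal if $f\equiv0$. $r$-harmonicity. Let $\{e_i\}$ be a local orthonormal frame of $M$ with $\langle e_i,e_j\rangle=\varepsilon_i\delta_{ij}$. For a smooth map $\varphi:M\to N$ of pseudo-Riemannian manifolds, $\tau(\varphi)=\sum_i\varepsilon_i[\nabla^\varphi_{e_i}d\varphi(e_i)-d\varphi(\nabla^M_{e_i}e_i)]$ and $\overline\Delta=-\sum_i\varepsilon_i(\nabla^\varphi_{e_i}\nabla^\varphi_{e_i}-\nabla^\varphi_{\nabla^M_{e_i}e_i})$ on sections of $\varphi^{-1}TN$, where $\nabla^\varphi$ is the induced connection. With $\tau=\tau(\varphi)$ and summation over $i$ understood, for $s\geq1$, $$\tau_{2s}(\varphi)=\overline\Delta^{2s-1}\tau-\varepsilon_iR^N(\overline\Delta^{2s-2}\tau,d\varphi(e_i))d\varphi(e_i)-\sum_{\ell=1}^{s-1}\{\varepsilon_iR^N(\nabla^\varphi_{e_i}\overline\Delta^{s+\ell-2}\tau,\overline\Delta^{s-\ell-1}\tau)d\varphi(e_i)-\varepsilon_iR^N(\overline\Delta^{s+\ell-2}\tau,\nabla^\varphi_{e_i}\overline\Delta^{s-\ell-1}\tau)d\varphi(e_i)\},$$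 $$\tau_{2s+1}(\varphi)=\overline\Delta^{2s}\tau-\varepsilon_iR^N(\overline\Delta^{2s-1}\tau,d\varphi(e_i))d\varphi(e_i)-\sum_{\ell=1}^{s-1}\{\varepsilon_iR^N(\nabla^\varphi_{e_i}\overline\Delta^{s+\ell-1}\tau,\overline\Delta^{s-\ell-1}\tau)d\varphi(e_i)-\varepsilon_iR^N(\overline\Delta^{s+\ell-1}\tau,\nabla^\varphi_{e_i}\overline\Delta^{s-\ell-1}\tau)d\varphi(e_i)\}-\varepsilon_iR^N(\nabla^\varphi_{e_i}\overline\Delta^{s-1}\tau,\overline\Delta^{s-1}\tau)d\varphi(e_i).$$ $\varphi$ is $r$-harmonic if $\tau_r(\varphi)=0$ ($r\ge2$). A hypersurface is $r$-harmonic if its isometric immersion is, and proper $r$-harmonic if in addition it is not minimal. *)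

(* Defs.v *)
From mathcomp Require Import all_boot all_order all_algebra.
From mathcomp Require Import all_classical all_reals all_analysis.

Set Implicit Arguments.
Unset Strict Implicit.
Unset Printing Implicit Defensive.

Import Order.TTheory GRing.Theory Num.Theory.
Import numFieldNormedType.Exports.

Local Open Scope classical_set_scope.
Local Open Scope ring_scope.

(* Coordinates are numbered from 0, so the t time-like coordinates of R^n_t
   are those of index i < t. *)
Definition pdot (R : realType) (n t : nat) (x y : 'rV[R]_n) : R :=
  - (\sum_(i < n | (i < t)%N) x 0 i * y 0 i)
  + \sum_(i < n | (t <= i)%N) x 0 i * y 0 i.

(* S^n_t(c); the ambient space R^(n+1)_t is 'rV_n.+1. *)
Definition pseudosphere (R : realType) (n t : nat) (c : R) : set 'rV[R]_n.+1 :=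
  [set x | pdot t x x = 1 / c].

Fixpoint Ck (R : realType) (p q k : nat) (O : set 'rV[R]_p)
    (f : 'rV[R]_p -> 'rV[R]_q) : Prop :=
  if k is k'.+1 then
    (forall x, O x -> differentiable f x) /\
    (forall v, Ck k' O (fun x => 'D_v f x))
  else forall x, O x -> {for x, continuous f}.

Definition smooth_on (R : realType) (p q : nat) (O : set 'rV[R]_p)
    (f : 'rV[R]_p -> 'rV[R]_q) : Prop := forall k, Ck k O f.

(* The velocities at x of the curves lying in M. *)
Definition tangent_space (R : realType) (p : nat) (M : set 'rV[R]_p)
    (x : 'rV[R]_p) : set 'rV[R]_p :=
  [set v | exists g : R -> 'rV[R]_p,
     [/\ g 0 = x, \forall s \near (0 : R), M (g s) & is_derive (0 : R) 1 g v]].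

(* Submanifolds M of R^p_t are handled through maps that are defined on all of
   'rV_p and smooth on an open set O of 'rV_p: such a map represents its
   restriction to the open subset of M cut out by O. Derivatives at points of M
   are only ever taken in directions tangent to M, so they do not depend on the
   values outside M. *)

(* (e_i) is a local orthonormal frame of M over O, <e_i, e_j> = eps_i delta_ij,
   for the metric induced on M by R^p_t. *)
Definition orthonormal_frame (R : realType) (p m t : nat) (M O : set 'rV[R]_p)
    (eps : 'I_m -> R) (e : 'I_m -> 'rV[R]_p -> 'rV[R]_p) : Prop :=
  [/\ forall i, eps i = 1 \/ eps i = -1,
      forall i, smooth_on O (e i),
      forall x, O x -> M x ->
        tangent_space M x =
        [set v | exists a : 'I_m -> R, v = \sum_(i < m) a i *: e i x]
    & forall x, O x -> M x -> forall i j,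
        pdot t (e i x) (e j x) = eps i *+ (i == j)].

Section Connections.

Variables (R : realType) (p q : nat).

Definition dmap (phi : 'rV[R]_p -> 'rV[R]_q) (X : 'rV[R]_p -> 'rV[R]_p)
    : 'rV[R]_p -> 'rV[R]_q :=
  fun x => 'D_(X x) phi x.

(* Connection induced on the sections of phi^{-1} TN by the Levi-Civita
   connection of N = S^(q-1)_u(c), that is by the tangential part of the flat
   connection of R^q_u. As <y, y> = 1/c on N, the orthogonal projection of w
   onto T_y N is w - c <w, y> y. *)
Definition nabla_phi (u : nat) (c : R) (phi : 'rV[R]_p -> 'rV[R]_q)
    (X : 'rV[R]_p -> 'rV[R]_p) (V : 'rV[R]_p -> 'rV[R]_q)
    : 'rV[R]_p -> 'rV[R]_q :=
  fun x => 'D_(X x) V x - (c * pdot u ('D_(X x) V x) (phi x)) *: phi x.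

(* Levi-Civita connection of a submanifold of R^p_t with orthonormal frame e:
   the tangential part of the flat connection of R^p_t. *)
Definition nablaM (m t : nat) (eps : 'I_m -> R)
    (e : 'I_m -> 'rV[R]_p -> 'rV[R]_p) (X Y : 'rV[R]_p -> 'rV[R]_p)
    : 'rV[R]_p -> 'rV[R]_p :=
  fun x => \sum_(j < m) (eps j * pdot t ('D_(X x) Y x) (e j x)) *: e j x.

Definition curv (u : nat) (c : R) (X Y Z : 'rV[R]_q) : 'rV[R]_q :=
  c *: (pdot u Y Z *: X - pdot u X Z *: Y).

End Connections.

(* The r-tension field of phi : M -> S^(q-1)_u(c), M a submanifold of R^p_t,
   computed in the orthonormal frame (e_i). *)
Section Tension.

Variables (R : realType) (p q m t u : nat) (c : R).
Variables (phi : 'rV[R]_p -> 'rV[R]_q).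
Variables (eps : 'I_m -> R) (e : 'I_m -> 'rV[R]_p -> 'rV[R]_p).

Local Notation D := (nabla_phi u c phi).
Local Notation Rm := (curv u c).
Local Notation E i := (dmap phi (e i)).

Definition tension : 'rV[R]_p -> 'rV[R]_q := fun x =>
  \sum_(i < m) eps i *:
    (D (e i) (E i) x - dmap phi (nablaM t eps e (e i) (e i)) x).

Definition rough_laplacian (V : 'rV[R]_p -> 'rV[R]_q)
    : 'rV[R]_p -> 'rV[R]_q := fun x =>
  - \sum_(i < m) eps i *:
      (D (e i) (D (e i) V) x - D (nablaM t eps e (e i) (e i)) V x).

Definition laptau (j : nat) : 'rV[R]_p -> 'rV[R]_q :=
  iter j rough_laplacian tension.

Definition tau_even (s : nat) : 'rV[R]_p -> 'rV[R]_q := fun x =>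
  laptau (2 * s - 1) x
  - \sum_(i < m) eps i *: Rm (laptau (2 * s - 2) x) (E i x) (E i x)
  - \sum_(1 <= l < s) \sum_(i < m)
      (eps i *: Rm (D (e i) (laptau (s + l - 2)) x)
                   (laptau (s - l - 1) x) (E i x)
       - eps i *: Rm (laptau (s + l - 2) x)
                     (D (e i) (laptau (s - l - 1)) x) (E i x)).

Definition tau_odd (s : nat) : 'rV[R]_p -> 'rV[R]_q := fun x =>
  laptau (2 * s) x
  - \sum_(i < m) eps i *: Rm (laptau (2 * s - 1) x) (E i x) (E i x)
  - \sum_(1 <= l < s) \sum_(i < m)
      (eps i *: Rm (D (e i) (laptau (s + l - 1)) x)
                   (laptau (s - l - 1) x) (E i x)
       - eps i *: Rm (laptau (s + l - 1) x)
                     (D (e i) (laptau (s - l - 1)) x) (E i x))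
  - \sum_(i < m) eps i *: Rm (D (e i) (laptau (s - 1)) x)
                             (laptau (s - 1) x) (E i x).

(* Meaningful for r >= 2 only. *)
Definition tau (r : nat) : 'rV[R]_p -> 'rV[R]_q :=
  if odd r then tau_odd r./2 else tau_even r./2.

End Tension.

(* M is an m-dimensional submanifold of R^p_t, phi : M -> S^(q-1)_u(c). *)
Definition r_harmonic_map (R : realType) (p q m t u : nat) (c : R)
    (M : set 'rV[R]_p) (phi : 'rV[R]_p -> 'rV[R]_q) (r : nat) : Prop :=
  forall (O : set 'rV[R]_p) (eps : 'I_m -> R)
         (e : 'I_m -> 'rV[R]_p -> 'rV[R]_p),
    open O -> orthonormal_frame t M O eps e ->
    forall x, O x -> M x -> tau t u c phi eps e r x = 0.

(* Hypersurfaces M of N = S^(m+1)_t(c); the immersion is the inclusion. *)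
Section Hypersurfaces.

Variables (R : realType) (m t : nat) (c : R) (M : set 'rV[R]_m.+2).

Definition unit_normal (O : set 'rV[R]_m.+2) (epsn : R)
    (eta : 'rV[R]_m.+2 -> 'rV[R]_m.+2) : Prop :=
  [/\ epsn = 1 \/ epsn = -1, smooth_on O eta &
      forall x, O x -> M x ->
        [/\ tangent_space (pseudosphere t c) x (eta x),
            forall v, tangent_space M x v -> pdot t (eta x) v = 0 &
            pdot t (eta x) (eta x) = epsn]].

Definition shape_operator (eta X : 'rV[R]_m.+2 -> 'rV[R]_m.+2)
    : 'rV[R]_m.+2 -> 'rV[R]_m.+2 :=
  fun x => - nabla_phi t c id X eta x.

Definition mean_curvature (eps : 'I_m -> R)
    (e : 'I_m -> 'rV[R]_m.+2 -> 'rV[R]_m.+2) (epsn : R)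
    (eta : 'rV[R]_m.+2 -> 'rV[R]_m.+2) (x : 'rV[R]_m.+2) : R :=
  m%:R^-1 * epsn *
  \sum_(i < m) eps i * pdot t (shape_operator eta (e i) x) (e i x).

Definition minimal : Prop :=
  forall (O : set 'rV[R]_m.+2) (eps : 'I_m -> R)
         (e : 'I_m -> 'rV[R]_m.+2 -> 'rV[R]_m.+2) (epsn : R)
         (eta : 'rV[R]_m.+2 -> 'rV[R]_m.+2),
    open O -> orthonormal_frame t M O eps e -> unit_normal O epsn eta ->
    forall x, O x -> M x -> mean_curvature eps e epsn eta x = 0.

Definition r_harmonic (r : nat) : Prop := r_harmonic_map m t t c M id r.

Definition proper_r_harmonic (r : nat) : Prop := r_harmonic r /\ ~ minimal.

End Hypersurfaces.

(* S^k_l(c) x S^(m-k)_(t-l)(c/(c-1)) in S^(m+1)_t; with coordinates numbered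
   from 0, the first factor uses the indices i < l and t <= i < t + k - l + 1,
   the second one the indices l <= i < t and t + k - l + 1 <= i < m + 2. *)
Definition pseudo_Clifford_torus (R : realType) (m t k l : nat) (c : R)
    : set 'rV[R]_m.+2 :=
  [set x | [/\ pseudosphere t 1 x,
     - (\sum_(i < m.+2 | (i < l)%N) x 0 i ^+ 2)
     + \sum_(i < m.+2 | (t <= i < t + (k - l) + 1)%N) x 0 i ^+ 2 = 1 / c &
     - (\sum_(i < m.+2 | (l <= i < t)%N) x 0 i ^+ 2)
     + \sum_(i < m.+2 | (t + (k - l) + 1 <= i)%N) x 0 i ^+ 2 = (c - 1) / c]].

(* Main.v *)
(* Let P be the coordinate projection onto the first factor. The linear field
   L x = c P x - x restricts to a normal field of M in the sphere, with
   <L x, L x> = c - 1, and v is tangent to M at x iff it is orthogonal to x and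
   L x. On a section equal to a L x along M with a constant, nabla_v gives
   a L v, and since L^2 = (c - 2) L + (c - 1) the rough Laplacian multiplies it
   by the constant S = T (c - 2) / (c - 1) + m, where T = k c - m is the trace
   of L on TM. The tension field is kappa L x with kappa = - T / (c - 1), hence
     tau_r = kappa S^(r-3) (S^2 - m S + (r - 2) T kappa) L x
           = - S^(r-3) (c - 1)^-3 T^2 P_3(c) L x
   with S > 0, while the mean curvature is a nonzero multiple of T. *)
Require Import Defs.
From mathcomp Require Import all_boot all_order all_algebra.
From mathcomp Require Import all_classical all_reals all_analysis.
From mathcomp Require Import ring zify.

Set Implicit Arguments.
Unset Strict Implicit.
Unset Printing Implicit Defensive.

Import Order.TTheory GRing.Theory Num.Theory.
Import numFieldNormedType.Exports.

Local Open Scope classical_set_scope.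
Local Open Scope ring_scope.

(** The fields live on open sets of the ambient space but are known in closed form only along [M].
    So each identity along [M] is carried together with smoothness on [O] and is differentiated only
    in tangent directions; this is what lets the Laplacian be iterated. The tension computation uses
    only two equations for [M] and the description of its tangent spaces, so it serves the torus and
    its components alike. That description requires actual curves, tangent vectors being velocities;
    rational conics treat space-like, time-like and null velocities uniformly. As [minimal]
    quantifies over all local frames and normals, its failure supplies a frame in one direction, but
    in the other [T = 0] can be extracted from it only after a frame has been built. Gram-Schmidt
    may meet null vectors in an indefinite metric, hence the use of reflections. One factor [T] of
    [tau_r] comes from [kappa], the other from [S - m], itself a multiple of [T]; the coefficient
    [r - 2] counts the curvature terms that pair a field with a derivative. *)

Lemma near_eq_differentiable (R : realType) (V W : normedModType R)
    (f g : V -> W) (x : V) :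
  (\near x, f x = g x) -> differentiable f x -> differentiable g x.
Proof.
move=> fg df; have -> : g = f + (g - f).
  by apply/funext => y; rewrite !fctE addrC subrK.
apply: differentiableD => //; set z := g - f.
have z0 : \forall y \near x, z y = 0.
  by near=> y; rewrite /z !fctE (near fg y)// subrr.
have c0 : continuous (\0 : V -> W) by exact: cst_continuous.
(* A function vanishing near [x] has the zero map as differential, its remainder being eventually
   0. *)
have zx : z \o shift x = cst (z x) + \0 +o_ 0 id.
  apply/eqaddoP => e e0.
  move: (z0); rewrite (near_shift 0) subr0 => z0'.
  near=> h.
  have zh : z (h + x) = 0 by exact: (near z0' h).
  by rewrite !fctE zh (nbhs_singleton z0) addr0 subrr normr0 mulr_ge0// ltW.
apply/diff_locallyP; have dz := diff_unique c0 zx.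
by rewrite dz.
Unshelve. all: by end_near. Qed.

(** * Smooth functions and fields *)

Section ScalarSmoothness.

Variables (R : realType) (p : nat) (O : set 'rV[R]_p).
Hypothesis openO : open O.
Implicit Types f g : 'rV[R]_p -> R.

(* Unlike Ck, cdiff 0 is trivial: only smoothness matters, and the condition
   at order 0 follows from the one at order 1. *)
Fixpoint cdiff (k : nat) f : Prop :=
  if k is k'.+1 then
    (forall x, O x -> differentiable f x) /\
    (forall v, cdiff k' (fun x => 'D_v f x))
  else True.

Definition smoothR f : Prop := forall k, cdiff k f.

Lemma near_open x (P : 'rV[R]_p -> Prop) :
  O x -> (forall y, O y -> P y) -> \forall y \near x, P y.
Proof. by move=> Ox H; near=> y; apply: H; near: y; exact: open_nbhs_nbhs.
Unshelve. all: by end_near. Qed.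

Lemma cdiff_eq k f g : (forall x, O x -> f x = g x) -> cdiff k f -> cdiff k g.
Proof.
elim: k f g => [//|k IH] f g fg [df Df]; split=> [x Ox|v].
  by apply: near_eq_differentiable (df x Ox); exact: near_open.
apply: IH (Df v) => x Ox; apply: near_eq_derive; exact: near_open.
Qed.

Lemma cdiffW k f : cdiff k.+1 f -> cdiff k f.
Proof.
by elim: k f => [//|k IH] f [df Df]; split=> // v; exact/IH/Df.
Qed.

Lemma cdiff_cst k (a : R) : cdiff k (fun=> a).
Proof.
elim: k a => [//|k IH] a; split=> [x _|v]; first exact: differentiable_cst.
by apply: cdiff_eq (IH 0) => x _; rewrite derive_cst.
Qed.

Lemma cdiffD k f g : cdiff k f -> cdiff k g -> cdiff k (fun x => f x + g x).
Proof.
elim: k f g => [//|k IH] f g [df Df] [dg Dg]; split=> [x Ox|v].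
  by apply: differentiableD; [exact: df|exact: dg].
apply: cdiff_eq (IH _ _ (Df v) (Dg v)) => x Ox.
by rewrite deriveD//; apply: diff_derivable; [exact: df|exact: dg].
Qed.

Lemma cdiffM k f g : cdiff k f -> cdiff k g -> cdiff k (fun x => f x * g x).
Proof.
elim: k f g => [//|k IH] f g cf cg; have [df Df] := cf; have [dg Dg] := cg.
split=> [x Ox|v]; first by apply: differentiableM; [exact: df|exact: dg].
apply: cdiff_eq
  (cdiffD (IH _ _ (cdiffW cf) (Dg v)) (IH _ _ (cdiffW cg) (Df v))).
by move=> x Ox; rewrite deriveM//; apply: diff_derivable; [exact: df|exact: dg].
Qed.

(** The induction closes because the derivative [- f^-2 D f] involves [f^-1] itself at one order
    less. *)
Lemma cdiffV k f : (forall x, O x -> f x != 0) -> cdiff k f ->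
  cdiff k (fun x => (f x)^-1).
Proof.
move=> f0; elim: k => [//|k IH] cf; have [df Df] := cf; split=> [x Ox|v].
  by apply: differentiableV; [exact: df|exact: f0].
have cV := IH (cdiffW cf).
apply: cdiff_eq (cdiffM (cdiffM (cdiff_cst k (-1)) (cdiffM cV cV)) (Df v)).
move=> x Ox; rewrite deriveV; [|exact: f0|exact/diff_derivable/df].
by rewrite /GRing.scale/= mulN1r expr2 invfM.
Qed.

Lemma smoothR_cst (a : R) : smoothR (fun=> a).
Proof. by move=> k; exact: cdiff_cst. Qed.

Lemma smoothRD f g : smoothR f -> smoothR g -> smoothR (fun x => f x + g x).
Proof. by move=> sf sg k; exact: cdiffD. Qed.

Lemma smoothRM f g : smoothR f -> smoothR g -> smoothR (fun x => f x * g x).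
Proof. by move=> sf sg k; exact: cdiffM. Qed.

Lemma smoothRV f : (forall x, O x -> f x != 0) -> smoothR f ->
  smoothR (fun x => (f x)^-1).
Proof. by move=> f0 sf k; exact: cdiffV. Qed.

Lemma smoothRN f : smoothR f -> smoothR (fun x => - f x).
Proof.
move=> sf k; apply: cdiff_eq (cdiffM (cdiff_cst k (-1)) (sf k)) => x _.
by rewrite mulN1r.
Qed.

Lemma smoothR_sum (I : Type) (s : seq I) (P : pred I) (F : I -> 'rV[R]_p -> R) :
  (forall i, P i -> smoothR (F i)) ->
  smoothR (fun x => \sum_(i <- s | P i) F i x).
Proof.
move=> sF k; elim: s => [|i s IH].
  by apply: cdiff_eq (cdiff_cst k 0) => x _; rewrite big_nil.
case: (boolP (P i)) => Pi.
  apply: cdiff_eq (cdiffD (sF i Pi k) IH) => x _; by rewrite big_cons Pi.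
by apply: cdiff_eq IH => x _; rewrite big_cons (negbTE Pi).
Qed.

Lemma smoothR_diff f : smoothR f -> forall x, O x -> differentiable f x.
Proof. by move=> sf; have [] := sf 1%N. Qed.

Lemma smoothR_derive f v : smoothR f -> smoothR (fun x => 'D_v f x).
Proof. by move=> sf k; have [_] := sf k.+1; apply. Qed.

Lemma smoothR_coord i : smoothR (fun x : 'rV[R]_p => x 0 i).
Proof.
case=> [//|k]; split=> [x _|v]; first exact: differentiable_coord.
apply: cdiff_eq (cdiff_cst k (v 0 i)) => x _.
have /derive_mx : derivable (@id 'rV[R]_p) x v by exact: derivable_id.
by rewrite derive_id => /matrixP /(_ 0 i); rewrite mxE.
Qed.

End ScalarSmoothness.

Section VectorSmoothness.

Variables (R : realType) (p : nat) (O : set 'rV[R]_p).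
Hypothesis openO : open O.

Definition smoothV q (V : 'rV[R]_p -> 'rV[R]_q) : Prop :=
  forall j, smoothR O (fun x => V x 0 j).

Lemma differentiable_rV q (V : 'rV[R]_p -> 'rV[R]_q) x :
  (forall j, differentiable (fun y => V y 0 j) x) -> differentiable V x.
Proof.
move=> dV; have -> : V = \sum_(j < q) (fun y => V y 0 j *: delta_mx 0 j).
  by apply/funext => y; rewrite fct_sumE [LHS]row_sum_delta.
by apply: differentiable_sum => j; exact/differentiableZl/dV.
Qed.

Lemma differentiable_rV_coord q (V : 'rV[R]_p -> 'rV[R]_q) x j :
  differentiable V x -> differentiable (fun y => V y 0 j) x.
Proof.
move=> dV.
apply: (@differentiable_comp _ _ _ _ V (fun M : 'rV_q => M 0 j)) => //.
exact: differentiable_coord.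
Qed.

Lemma derive_coord q (V : 'rV[R]_p -> 'rV[R]_q) x v j :
  differentiable V x -> ('D_v V x) 0 j = 'D_v (fun y => V y 0 j) x.
Proof. by move=> dV; rewrite derive_mx ?mxE//; exact: diff_derivable. Qed.

Lemma derive_sum_delta q (V : 'rV[R]_p -> 'rV[R]_q) x v :
  differentiable V x -> 'D_v V x = \sum_(i < p) v 0 i *: 'D_(delta_mx 0 i) V x.
Proof.
move=> dV; rewrite deriveE// {1}(row_sum_delta v) linear_sum.
by apply: eq_bigr => i _; rewrite linearZ /= deriveE.
Qed.

Lemma smoothV_diff q (V : 'rV[R]_p -> 'rV[R]_q) :
  smoothV V -> forall x, O x -> differentiable V x.
Proof.
move=> sV x Ox; apply: differentiable_rV => j.
exact: smoothR_diff (sV j) x Ox.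
Qed.

Lemma Ck_cdiff q k (V : 'rV[R]_p -> 'rV[R]_q) j :
  Ck k O V -> cdiff O k (fun x => V x 0 j).
Proof.
elim: k V => [//|k IH] V [dV DV]; split=> [x Ox|v].
  exact/differentiable_rV_coord/dV.
apply: (cdiff_eq openO _ (IH _ (DV v))) => x Ox.
by rewrite derive_coord//; exact: dV.
Qed.

Lemma smooth_onV q (V : 'rV[R]_p -> 'rV[R]_q) : smooth_on O V -> smoothV V.
Proof. by move=> sV j k; exact/Ck_cdiff/sV. Qed.

(** One order is lost: [Ck 0] asks for continuity, which here comes from differentiability at order
    1. *)
Lemma cdiff_Ck q k (V : 'rV[R]_p -> 'rV[R]_q) :
  (forall j, cdiff O k.+1 (fun x => V x 0 j)) -> Ck k O V.
Proof.
elim: k V => [|k IH] V cV.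
  move=> x Ox; apply/differentiable_continuous/differentiable_rV => j.
  by have [dV _] := cV j; exact: dV.
have dV x : O x -> differentiable V x.
  by move=> Ox; apply: differentiable_rV => j; have [dV _] := cV j; exact: dV.
split=> [//|v]; apply: IH => j; have [_ DV] := cV j.
apply: (@cdiff_eq _ _ _ openO k.+1 _ _ _ (DV v)) => x Ox.
by rewrite derive_coord//; exact: dV.
Qed.

Lemma smoothV_on q (V : 'rV[R]_p -> 'rV[R]_q) : smoothV V -> smooth_on O V.
Proof. by move=> sV k; apply: cdiff_Ck => j; exact: sV. Qed.

Lemma smoothV_cst q (w : 'rV[R]_q) : smoothV (fun=> w).
Proof. by move=> j; exact: smoothR_cst. Qed.

Lemma smoothV_id : smoothV (@id 'rV[R]_p).
Proof. by move=> j; exact: smoothR_coord. Qed.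

Lemma smoothVD q (V W : 'rV[R]_p -> 'rV[R]_q) :
  smoothV V -> smoothV W -> smoothV (fun x => V x + W x).
Proof.
move=> sV sW j k; apply: cdiff_eq (smoothRD openO (sV j) (sW j) k) => // x _.
by rewrite mxE.
Qed.

Lemma smoothVN q (V : 'rV[R]_p -> 'rV[R]_q) :
  smoothV V -> smoothV (fun x => - V x).
Proof.
move=> sV j k; apply: cdiff_eq (smoothRN openO (sV j) k) => // x _.
by rewrite mxE.
Qed.

Lemma smoothVB q (V W : 'rV[R]_p -> 'rV[R]_q) :
  smoothV V -> smoothV W -> smoothV (fun x => V x - W x).
Proof. by move=> sV sW; apply: smoothVD => //; exact: smoothVN. Qed.

Lemma smoothVZ q (f : 'rV[R]_p -> R) (V : 'rV[R]_p -> 'rV[R]_q) :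
  smoothR O f -> smoothV V -> smoothV (fun x => f x *: V x).
Proof.
move=> sf sV j k; apply: cdiff_eq (smoothRM openO sf (sV j) k) => // x _.
by rewrite mxE.
Qed.

Lemma smoothV_sum q n (F : 'I_n -> 'rV[R]_p -> 'rV[R]_q) :
  (forall i, smoothV (F i)) -> smoothV (fun x => \sum_(i < n) F i x).
Proof.
move=> sF j k.
have sS : smoothR O (fun x => \sum_(i < n) F i x 0 j).
  by apply: smoothR_sum => // i _; exact: sF.
by apply: cdiff_eq (sS k) => // x _; rewrite summxE.
Qed.

(** The direction varies with the point, so the derivative is expanded along the fixed coordinate
    directions, with smooth coefficients. *)
Lemma smoothV_derive q (X : 'rV[R]_p -> 'rV[R]_p) (V : 'rV[R]_p -> 'rV[R]_q) :
  smoothV X -> smoothV V -> smoothV (fun x => 'D_(X x) V x).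
Proof.
move=> sX sV j k.
have sS : smoothR O (fun x =>
    \sum_(i < p) X x 0 i * 'D_(delta_mx 0 i) (fun y => V y 0 j) x).
  apply: smoothR_sum => // i _; apply: smoothRM => //.
  exact: smoothR_derive.
apply: cdiff_eq (sS k) => // x Ox; have dV := smoothV_diff sV Ox.
rewrite derive_sum_delta// summxE; apply: eq_bigr => i _.
by rewrite mxE derive_coord.
Qed.

Lemma smoothR_pdot q t (V W : 'rV[R]_p -> 'rV[R]_q) :
  smoothV V -> smoothV W -> smoothR O (fun x => pdot t (V x) (W x)).
Proof.
move=> sV sW; apply: smoothRD => //; first apply: smoothRN => //.
  by apply: smoothR_sum => // i _; exact: smoothRM.
by apply: smoothR_sum => // i _; exact: smoothRM.
Qed.

End VectorSmoothness.

(** * The pseudo-Euclidean product and coordinate projections *)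

Section PseudoEuclidean.

Variables (R : realType) (n t : nat).
Implicit Types (x y z : 'rV[R]_n) (A : pred 'I_n).

Lemma pdotE x y : pdot t x y = \sum_(i < n) (-1) ^+ (i < t)%N * (x 0 i * y 0 i).
Proof.
rewrite /pdot -sumrN big_mkcond [X in _ + X]big_mkcond -big_split.
apply: eq_bigr => i _ /=; case: (ltnP i t) => _.
  by rewrite addr0 expr1 mulN1r.
by rewrite add0r expr0 mul1r.
Qed.

Lemma pdotC x y : pdot t x y = pdot t y x.
Proof. by rewrite !pdotE; apply: eq_bigr => i _; rewrite (mulrC (x 0 i)). Qed.

Lemma pdotDl x y z : pdot t (x + y) z = pdot t x z + pdot t y z.
Proof.
rewrite !pdotE -big_split; apply: eq_bigr => i _ /=.
by rewrite mxE mulrDl mulrDr.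
Qed.

Lemma pdotZl a x y : pdot t (a *: x) y = a * pdot t x y.
Proof.
rewrite !pdotE mulr_sumr; apply: eq_bigr => i _.
by rewrite mxE -mulrA mulrCA.
Qed.

Lemma pdotNl x y : pdot t (- x) y = - pdot t x y.
Proof. by rewrite -scaleN1r pdotZl mulN1r. Qed.

Lemma pdotBl x y z : pdot t (x - y) z = pdot t x z - pdot t y z.
Proof. by rewrite pdotDl pdotNl. Qed.

Lemma pdot0l y : pdot t 0 y = 0.
Proof. by rewrite -(scale0r 0) pdotZl mul0r. Qed.

Lemma pdot_suml (I : Type) (s : seq I) (P : pred I) (F : I -> 'rV[R]_n) y :
  pdot t (\sum_(i <- s | P i) F i) y = \sum_(i <- s | P i) pdot t (F i) y.
Proof.
by elim/big_rec2 : _ => [|i a b _ <-]; rewrite ?pdot0l ?pdotDl.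
Qed.

Lemma pdotDr x y z : pdot t z (x + y) = pdot t z x + pdot t z y.
Proof. by rewrite !(pdotC z) pdotDl. Qed.

Lemma pdotZr a x y : pdot t y (a *: x) = a * pdot t y x.
Proof. by rewrite !(pdotC y) pdotZl. Qed.

Lemma pdotBr x y z : pdot t z (x - y) = pdot t z x - pdot t z y.
Proof. by rewrite !(pdotC z) pdotBl. Qed.

Lemma pdot_delta i y : pdot t (delta_mx 0 i) y = (-1) ^+ (i < t)%N * y 0 i.
Proof.
rewrite pdotE (bigD1 i)//= mxE !eqxx mul1r big1 ?addr0// => j ji.
by rewrite mxE (negbTE ji) andbF mul0r mulr0.
Qed.

Definition proj A x : 'rV[R]_n := \row_j (if A j then x 0 j else 0).

Lemma projD A x y : proj A (x + y) = proj A x + proj A y.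
Proof. by apply/rowP => j; rewrite !mxE; case: ifP; rewrite ?addr0. Qed.

Lemma projZ A a x : proj A (a *: x) = a *: proj A x.
Proof. by apply/rowP => j; rewrite !mxE; case: ifP; rewrite ?mulr0. Qed.

Lemma projN A x : proj A (- x) = - proj A x.
Proof. by rewrite -scaleN1r projZ scaleN1r. Qed.

Lemma projB A x y : proj A (x - y) = proj A x - proj A y.
Proof. by rewrite projD projN. Qed.

Lemma projK A x : proj A (proj A x) = proj A x.
Proof. by apply/rowP => j; rewrite !mxE; case: (A j). Qed.

Lemma proj_delta A i :
  proj A (delta_mx 0 i) = if A i then delta_mx 0 i else 0.
Proof.
apply/rowP => j; rewrite !mxE /=; have [->|ji] := eqVneq j i.
  by case: (A i); rewrite !mxE ?eqxx.
by case: (A i); case: (A j); rewrite !mxE ?(negbTE ji).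
Qed.

Lemma proj_sym A x y : pdot t (proj A x) y = pdot t x (proj A y).
Proof.
rewrite !pdotE; apply: eq_bigr => i _; rewrite !mxE.
by case: (A i); rewrite ?(mulr0, mul0r).
Qed.

Lemma pdot_proj A x y : pdot t (proj A x) (proj A y) = pdot t (proj A x) y.
Proof. by rewrite -proj_sym projK. Qed.

End PseudoEuclidean.

(** * Derivatives of products and projections, tangent vectors, rational curves *)

Section Calculus.

Variables (R : realType) (p q t : nat).
Implicit Types (V W : 'rV[R]_p -> 'rV[R]_q) (x v : 'rV[R]_p).

Lemma differentiable_proj (A : pred 'I_q) V x : differentiable V x ->
  differentiable (fun y => proj A (V y)) x.
Proof.
move=> dV; apply: differentiable_rV => j; case: (boolP (A j)) => Aj.
  rewrite (_ : (fun y => _) = (fun y => V y 0 j)); last first.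
    by apply/funext => y; rewrite mxE Aj.
  exact: (@differentiable_rV_coord R p q V).
rewrite (_ : (fun y => _) = (fun=> 0)); first exact: differentiable_cst.
by apply/funext => y; rewrite mxE (negbTE Aj).
Qed.

Lemma derive_proj (A : pred 'I_q) V x v : differentiable V x ->
  'D_v (fun y => proj A (V y)) x = proj A ('D_v V x).
Proof.
move=> dV; apply/rowP => j.
rewrite derive_coord; last exact: differentiable_proj.
rewrite mxE derive_coord//; case: ifPn => Aj.
  by congr ('D_v _ x); apply/funext => y; rewrite mxE Aj.
rewrite -(derive_cst (0 : R) x v); congr ('D_v _ x).
by apply/funext => y; rewrite mxE (negbTE Aj).
Qed.

Lemma smoothV_proj (O : set 'rV[R]_p) (A : pred 'I_q) V :
  open O -> smoothV O V -> smoothV O (fun y => proj A (V y)).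
Proof.
move=> oO sV j i; case: (boolP (A j)) => Aj.
  by apply: cdiff_eq (sV j i) => // y _; rewrite mxE Aj.
by apply: cdiff_eq (cdiff_cst oO i 0) => // y _; rewrite mxE (negbTE Aj).
Qed.

Lemma derive_pdot V W x v : differentiable V x -> differentiable W x ->
  'D_v (fun y => pdot t (V y) (W y)) x
  = pdot t ('D_v V x) (W x) + pdot t (V x) ('D_v W x).
Proof.
move=> dV dW; rewrite !pdotE.
have -> : (fun y => pdot t (V y) (W y)) =
    \sum_(i < q) (fun y => (-1) ^+ (i < t)%N *: (V y 0 i * W y 0 i)).
  by apply/funext => y; rewrite pdotE fct_sumE.
have dc i : derivable (fun y => V y 0 i * W y 0 i) x v.
  by apply: derivableM; exact/diff_derivable/differentiable_rV_coord.
rewrite derive_sum => [|i]; last exact: derivableZ.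
rewrite -big_split; apply: eq_bigr => i _ /=.
rewrite deriveZ//= deriveM;
  [|exact/diff_derivable/differentiable_rV_coord..].
rewrite !derive_coord// /GRing.scale/= -mulrDr; congr (_ * _).
by rewrite addrC (mulrC (W x 0 i)).
Qed.

Lemma differentiable_pdot V W x : differentiable V x -> differentiable W x ->
  differentiable (fun y => pdot t (V y) (W y)) x.
Proof.
move=> dV dW.
have -> : (fun y => pdot t (V y) (W y)) =
    \sum_(i < q) (fun y => (-1) ^+ (i < t)%N *: (V y 0 i * W y 0 i)).
  by apply/funext => y; rewrite pdotE fct_sumE.
apply: differentiable_sum => i; apply: differentiableZ.
by apply: differentiableM; exact: differentiable_rV_coord.
Qed.

End Calculus.

(* A derivative in a direction tangent to M only depends on the values on M. *)
Lemma tangent_derive_eq (R : realType) (p : nat) (W : normedModType R)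
    (M O : set 'rV[R]_p) (F G : 'rV[R]_p -> W) x v :
  open O -> O x -> tangent_space M x v ->
  differentiable F x -> differentiable G x ->
  (forall y, O y -> M y -> F y = G y) -> 'D_v F x = 'D_v G x.
Proof.
move=> oO Ox [g [g0 gM [dg <-]]] dF dG FG.
have dg' : differentiable g 0 by exact/derivable1_diffP.
have comp (H : 'rV[R]_p -> W) : differentiable H x ->
    'D_('D_1 g 0) H x = 'D_1 (H \o g) 0.
  rewrite -g0 => dH; rewrite (@deriveE _ _ _ H)// (@deriveE _ _ _ g)//.
  rewrite deriveE; last exact: differentiable_comp.
  by rewrite (diff_comp dg' dH).
rewrite !comp//; apply: near_eq_derive.
have gO : \forall s \near (0 : R), O (g s).
  apply: (differentiable_continuous dg').
  by rewrite /= g0; exact: open_nbhs_nbhs.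
by near=> s; apply: FG; [near: s|exact: (near gM s)].
Unshelve. all: by end_near. Qed.

(** Differentiating the constant [<y, y>] along a curve of the sphere gives [2 <v, x> = 0]. *)
Lemma pseudosphere_tangent (R : realType) (n t : nat) (c : R)
    (x v : 'rV[R]_n.+1) :
  tangent_space (pseudosphere t c) x v -> pdot t v x = 0.
Proof.
move=> tv; have dI : differentiable (@id 'rV[R]_n.+1) x by exact: ex_diff.
have : 'D_v (fun y => pdot t (id y) (id y)) x = 0.
  rewrite (@tangent_derive_eq _ _ _ (pseudosphere t c) setT _ (fun=> 1 / c))//.
  - by rewrite derive_cst.
  - exact: openT.
  - exact: differentiable_pdot.
rewrite derive_pdot// derive_id (pdotC _ x) -mulr2n => /eqP.
by rewrite mulrn_eq0 => /eqP.
Qed.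

Section RationalCurve.

Variables (R : realType) (n : nat).
Implicit Types (a s : R) (x v : 'rV[R]_n).

(* Stereographic parametrisation of the conic through x with velocity v: with
   a = <v, v> / (4 <x, x>) and <x, v> = 0 it has constant norm. *)
Definition conic a x v s : 'rV[R]_n :=
  ((1 - a * s ^+ 2) / (1 + a * s ^+ 2)) *: x + (s / (1 + a * s ^+ 2)) *: v.

Lemma conic0 a x v : conic a x v 0 = x.
Proof.
rewrite /conic expr0n/= mulr0 addr0 subr0 invr1 mulr1 scale1r mul0r.
by rewrite scale0r addr0.
Qed.

Let differentiable_quad a s : differentiable (fun s : R => 1 + a * s ^+ 2) s.
Proof.
apply: differentiableD; first exact: differentiable_cst.
exact: (@differentiableM _ _ (fun=> a) (fun s : R => s * s)).
Qed.

Lemma near_conic a : \forall s \near (0 : R), 1 + a * s ^+ 2 != 0.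
Proof.
have : nbhs (1 + a * 0 ^+ 2) [set z : R | z != 0].
  apply: open_nbhs_nbhs; split; first exact: open_neq.
  by rewrite /= expr0n/= mulr0 addr0 oner_neq0.
by move/(differentiable_continuous (differentiable_quad a 0)).
Qed.

Lemma differentiable_conic a x v s :
  1 + a * s ^+ 2 != 0 -> differentiable (conic a x v) s.
Proof.
move=> nz.
have dV : differentiable (fun s : R => (1 + a * s ^+ 2)^-1) s.
  exact: differentiableV.
apply: differentiableD; apply: differentiableZl.
  have -> : (fun s : R => (1 - a * s ^+ 2) / (1 + a * s ^+ 2))
      = (fun s => (1 + - a * s ^+ 2) * (1 + a * s ^+ 2)^-1).
    by apply/funext => u; rewrite mulNr.
  exact: differentiableM.
exact: differentiableM.
Qed.

Lemma derive_conic a x v : is_derive (0 : R) 1 (conic a x v) v.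
Proof.
have d0 : differentiable (conic a x v) 0.
  by apply: differentiable_conic; rewrite expr0n/= mulr0 addr0 oner_neq0.
apply: DeriveDef; first exact: diff_derivable.
have dV : differentiable (fun s : R => (1 + a * s ^+ 2)^-1) 0.
  by apply: differentiableV => //; rewrite expr0n/= mulr0 addr0 oner_neq0.
(* This function is the difference quotient of the conic at 0, simplified so that it extends
   continuously to [s = 0], where its value is [v]. *)
have dg : differentiable (fun s : R =>
   ((- (2 * a)) * s * (1 + a * s ^+ 2)^-1) *: x + (1 + a * s ^+ 2)^-1 *: v) 0.
  apply: differentiableD; apply: differentiableZl => //.
  apply: differentiableM => //; apply: differentiableM => //.
apply: cvg_lim => //.
move/differentiable_continuous : dg => /continuous_withinNx /=.
rewrite mulr0 mul0r scale0r add0r expr0n/= mulr0 addr0 invr1 scale1r.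
apply: cvg_trans; apply: near_eq_cvg; near=> h.
have h0 : h != 0 by near: h; exact: nbhs_dnbhs_neq.
have hq : 1 + a * h ^+ 2 != 0.
  by near: h; apply: (@nbhs_dnbhs _ (0 : R)); exact: near_conic.
rewrite /= conic0 /conic [h *: 1]mulr1 addr0.
rewrite addrAC -{3}(scale1r x) -scalerBl scalerDr !scalerA.
congr (_ *: _ + _ *: _); field; exact/andP.
Unshelve. all: by end_near. Qed.

End RationalCurve.

Lemma pdot_proj_diag (R : realType) (n t : nat) (A : pred 'I_n) (y : 'rV[R]_n) :
  pdot t (proj A y) y = \sum_(i < n | A i) (-1) ^+ (i < t)%N * y 0 i ^+ 2.
Proof.
rewrite pdotE [RHS]big_mkcond; apply: eq_bigr => i _.
by rewrite mxE; case: (A i); rewrite ?expr2// mul0r mulr0.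
Qed.

(** * Tension fields and mean curvature *)

Section CliffordHypersurface.

Variables (R : realType) (m k t : nat) (c : R) (A : pred 'I_m.+2).
Variable M : set 'rV[R]_m.+2.
Hypothesis c_gt1 : 1 < c.
Hypothesis cardA : #|A| = k.+1.
Hypothesis M_sphere : forall x, M x -> pdot t x x = 1.
Hypothesis M_factor : forall x, M x -> pdot t (proj A x) x = c^-1.
Hypothesis M_tangent : forall x v, M x ->
  tangent_space M x v <-> pdot t v x = 0 /\ pdot t (proj A v) x = 0.

Implicit Types (x v w y : 'rV[R]_m.+2).

(* The field x |-> torus_op x is normal to M in the sphere, of square norm
   c - 1; being linear it is its own derivative, so that on tangent vectors
   torus_op is the shape operator up to a factor - sqrt (c - 1). Locked, as
   rewriting with pdotBl would otherwise unfold it. *)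
Definition torus_op : 'rV[R]_m.+2 -> 'rV[R]_m.+2 :=
  locked (fun v => c *: proj A v - v).

Local Notation L := torus_op.

Lemma torus_opE v : L v = c *: proj A v - v.
Proof. by rewrite /torus_op -lock. Qed.

Let c_neq0 : c != 0. Proof. by rewrite gt_eqF// (lt_trans ltr01). Qed.
Let c1_neq0 : c - 1 != 0. Proof. by rewrite subr_eq0 gt_eqF. Qed.

Lemma torus_opD v w : L (v + w) = L v + L w.
Proof. by rewrite !torus_opE projD scalerDr opprD addrACA. Qed.

Lemma torus_opZ a v : L (a *: v) = a *: L v.
Proof. by rewrite !torus_opE projZ scalerBr !scalerA mulrC. Qed.

Lemma torus_opN v : L (- v) = - L v.
Proof. by rewrite -scaleN1r torus_opZ scaleN1r. Qed.

Lemma torus_opB v w : L (v - w) = L v - L w.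
Proof. by rewrite torus_opD torus_opN. Qed.

Lemma torus_op_sym v w : pdot t (L v) w = pdot t v (L w).
Proof. by rewrite !torus_opE pdotBl pdotBr pdotZl pdotZr proj_sym. Qed.

(** [proj A] is idempotent, so [L] has eigenvalue [c - 1] on the first factor and [-1] on the
    second; these are the roots of [X^2 = (c - 2) X + (c - 1)]. *)
Lemma torus_op_sqr v : L (L v) = (c - 2) *: L v + (c - 1) *: v.
Proof.
rewrite !torus_opE projB projZ projK; apply/rowP => j; rewrite !mxE; ring.
Qed.

Lemma pdot_normal_pos x : M x -> pdot t (L x) x = 0.
Proof.
move=> Mx; rewrite !torus_opE pdotBl pdotZl M_factor// M_sphere//.
by rewrite divff// subrr.
Qed.

Lemma pdot_normal x : M x -> pdot t (L x) (L x) = c - 1.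
Proof.
move=> Mx; rewrite -torus_op_sym torus_op_sqr pdotDl !pdotZl pdot_normal_pos//.
by rewrite M_sphere// mulr0 add0r mulr1.
Qed.

Lemma tangentP x v : M x ->
  tangent_space M x v <-> pdot t v x = 0 /\ pdot t v (L x) = 0.
Proof.
move=> Mx; apply: iff_trans (M_tangent v Mx) _.
rewrite !torus_opE pdotBr pdotZr -proj_sym; split=> -[-> /eqP].
  by move=> /eqP ->; rewrite mulr0 subrr.
by rewrite subr0 mulf_eq0 (negbTE c_neq0) /= => /eqP.
Qed.

(** By symmetry of [L]. It makes the projection term of [nabla_phi] vanish on [L v]. *)
Lemma tangent_torus_op x v : M x -> tangent_space M x v ->
  pdot t (L v) x = 0.
Proof. by move=> Mx /(tangentP _ Mx)[_]; rewrite torus_op_sym. Qed.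

Section Frame.

Variables (O : set 'rV[R]_m.+2) (eps : 'I_m -> R).
Variable e : 'I_m -> 'rV[R]_m.+2 -> 'rV[R]_m.+2.
Hypothesis openO : open O.
Hypothesis frame : orthonormal_frame t M O eps e.

Lemma eps_sqr i : eps i * eps i = 1.
Proof.
by case: frame => /(_ i) + _ _ _ => -[] ->; rewrite ?mulr1// mulrNN mulr1.
Qed.

Lemma frame_smooth i : smoothV O (e i).
Proof. by case: frame => _ + _ _ => /(_ i); exact: smooth_onV. Qed.

Section Point.

Variable x : 'rV[R]_m.+2.
Hypotheses (Ox : O x) (Mx : M x).

Lemma frame_dot i j : pdot t (e i x) (e j x) = eps i *+ (i == j).
Proof. by case: frame => _ _ _; apply. Qed.

Lemma frame_tangent i : tangent_space M x (e i x).
Proof.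
case: frame => _ _ /(_ x Ox Mx) -> _; exists (fun j => (j == i)%:R).
rewrite (bigD1 i)//= eqxx scale1r big1 ?addr0// => j ji.
by rewrite (negbTE ji) scale0r.
Qed.

(** The [e j x], [L x] and [x] form an orthogonal basis of the ambient space: removing the two
    normal components leaves a tangent vector, whose frame coefficients are read off by pairing with
    [e j x]. *)
Lemma frame_decomp w : w = \sum_(j < m) (eps j * pdot t w (e j x)) *: e j x
  + (pdot t w (L x) / (c - 1)) *: L x + pdot t w x *: x.
Proof.
set b := _ / _; set d := pdot t w x.
have [a ua] : exists a : 'I_m -> R,
    w - b *: L x - d *: x = \sum_(i < m) a i *: e i x.
  case: frame => _ _ /(_ x Ox Mx) tE _.
  suff : tangent_space M x (w - b *: L x - d *: x) by rewrite tE.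
  apply/(tangentP _ Mx); rewrite !pdotBl !pdotZl pdot_normal_pos// M_sphere//.
  rewrite (pdotC _ x) pdot_normal_pos// pdot_normal//.
  by rewrite /b divfK// !mulr0 subr0 mulr1 !subrr.
have aE j : a j = eps j * pdot t w (e j x).
  have : pdot t (w - b *: L x - d *: x) (e j x) = a j * eps j.
    rewrite ua pdot_suml (bigD1 j)//= pdotZl frame_dot eqxx mulr1n.
    rewrite big1 ?addr0//.
    by move=> i ij; rewrite pdotZl frame_dot (negbTE ij) mulr0n mulr0.
  have /(tangentP _ Mx)[e1 e2] := frame_tangent j.
  rewrite !pdotBl !pdotZl !(pdotC _ _ (e j x)) e1 e2 !mulr0 !subr0 => ->.
  by rewrite mulrCA eps_sqr mulr1.
rewrite -[LHS](subrK (d *: x)); congr (_ + _).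
rewrite -[LHS](subrK (b *: L x)) (addrAC w) ua; congr (_ + _).
by apply: eq_bigr => j _; rewrite aE.
Qed.

Lemma frame_trace_id : \sum_(i < m) eps i * pdot t (e i x) (e i x) = m%:R.
Proof.
under eq_bigr do rewrite frame_dot eqxx mulr1n eps_sqr.
by rewrite sumr_const card_ord.
Qed.

(** The trace of [proj A] on the whole space is [#|A| = k + 1]; in the orthogonal basis of
    [frame_decomp] the directions [L x] and [x] contribute [(c - 1) / c] and [1 / c] to it, together
    1. *)
Lemma frame_trace_proj :
  \sum_(i < m) eps i * pdot t (proj A (e i x)) (e i x) = k%:R.
Proof.
(* The [a]-th coordinate of the decomposition of the [a]-th basis vector; summed over [A] it yields
   the trace. *)
have E (a : 'I_m.+2) : 1 =
     \sum_(j < m) eps j * ((-1) ^+ (a < t)%N * e j x 0 a ^+ 2)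
   + (-1) ^+ (a < t)%N * L x 0 a ^+ 2 / (c - 1)
   + (-1) ^+ (a < t)%N * x 0 a ^+ 2.
  have /rowP/(_ a) := frame_decomp (delta_mx 0 a).
  rewrite !pdot_delta mxE !eqxx /= => E; rewrite [LHS]E !mxE summxE.
  congr (_ + _ + _); [|ring|ring].
  by apply: eq_bigr => j _; rewrite !mxE pdot_delta; ring.
have : (k.+1)%:R = \sum_(a < m.+2 | A a) (1 : R).
  by rewrite sumr_const -cardA.
rewrite (eq_bigr _ (fun a _ => E a)) !big_split /= -mulr_suml -!pdot_proj_diag.
rewrite exchange_big /=.
under eq_bigr => j _ do rewrite -mulr_sumr -pdot_proj_diag.
rewrite (M_factor Mx) -pdot_proj; set S := \sum_(i < m) _.
have -> : proj A (L x) = (c - 1) *: proj A x.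
  by rewrite !torus_opE projB projZ projK scalerBl scale1r.
rewrite pdotZl pdotZr pdot_proj M_factor// -natr1 => H.
apply: (addIr 1); rewrite H -addrA; congr (_ + _).
by field; rewrite c_neq0.
Qed.

Definition torus_trace : R := k%:R * c - m%:R.
Local Notation T := torus_trace.

Lemma frame_trace : \sum_(i < m) eps i * pdot t (L (e i x)) (e i x) = T.
Proof.
rewrite /T -frame_trace_proj -frame_trace_id mulr_suml -sumrB.
by apply: eq_bigr => i _; rewrite torus_opE pdotBl pdotZl; ring.
Qed.

End Point.

Local Notation T := torus_trace.

Lemma smoothV_torus_op (V : 'rV[R]_m.+2 -> 'rV[R]_m.+2) :
  smoothV O V -> smoothV O (fun y => L (V y)).
Proof.
move=> sV; have -> : (fun y => L (V y)) = (fun y => c *: proj A (V y) - V y).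
  by apply/funext => y; rewrite torus_opE.
apply: smoothVB => //; apply: smoothVZ => //; first exact: smoothR_cst.
exact: smoothV_proj.
Qed.

Lemma smoothV_normal : smoothV O L.
Proof. by apply: (@smoothV_torus_op id); exact: smoothV_id. Qed.

Lemma derive_torus_op (V : 'rV[R]_m.+2 -> 'rV[R]_m.+2) x v :
  differentiable V x -> 'D_v (fun y => L (V y)) x = L ('D_v V x).
Proof.
move=> dV; have dP := differentiable_proj A dV; rewrite torus_opE.
have -> : (fun y => L (V y)) = (fun y => c *: proj A (V y) - V y).
  by apply/funext => y; rewrite torus_opE.
rewrite deriveB; [|exact/diff_derivable/differentiableZ|exact: diff_derivable].
by rewrite deriveZ ?derive_proj//; exact: diff_derivable.
Qed.

Lemma smoothV_nabla q u d (phi : 'rV[R]_m.+2 -> 'rV[R]_q)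
    (X : 'rV[R]_m.+2 -> 'rV[R]_m.+2) (V : 'rV[R]_m.+2 -> 'rV[R]_q) :
  smoothV O phi -> smoothV O X -> smoothV O V ->
  smoothV O (nabla_phi u d phi X V).
Proof.
move=> sphi sX sV; have sD := smoothV_derive openO sX sV.
apply: smoothVB => //; apply: smoothVZ => //; apply: smoothRM => //.
  exact: smoothR_cst.
exact: smoothR_pdot.
Qed.

Lemma smoothV_nablaM i : smoothV O (nablaM t eps e (e i) (e i)).
Proof.
apply: smoothV_sum => // j; apply: smoothVZ => //; last exact: frame_smooth.
apply: smoothRM => //; first exact: smoothR_cst.
by apply: smoothR_pdot => //; [apply: smoothV_derive => //|];
  exact: frame_smooth.
Qed.

Lemma smoothV_laplacian (V : 'rV[R]_m.+2 -> 'rV[R]_m.+2) :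
  smoothV O V -> smoothV O (rough_laplacian t t 1 id eps e V).
Proof.
move=> sV; have sI := @smoothV_id _ _ _ openO.
apply: smoothVN => //; apply: smoothV_sum => // i.
apply: smoothVZ => //; first exact: smoothR_cst.
have se := frame_smooth i; have sM := smoothV_nablaM i.
by apply: smoothVB => //; do ?apply: smoothV_nabla.
Qed.

Lemma dmap_id (X : 'rV[R]_m.+2 -> 'rV[R]_m.+2) : dmap id X = X.
Proof. by apply/funext => y; rewrite /dmap derive_id. Qed.

Lemma smoothV_tension : smoothV O (tension t t 1 id eps e).
Proof.
have sI := @smoothV_id _ _ _ openO.
apply: smoothV_sum => // i; apply: smoothVZ => //; first exact: smoothR_cst.
have se := frame_smooth i; have sM := smoothV_nablaM i.
by rewrite !dmap_id; apply: smoothVB => //; apply: smoothV_nabla.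
Qed.

Section PointDerivatives.

Variable x : 'rV[R]_m.+2.
Hypotheses (Ox : O x) (Mx : M x).

(** Differentiate [<Y, y> = 0] and [<Y, L y> = 0], valid along [M], in the tangent direction [v];
    [L] is its own derivative. *)
Lemma derive_tangent_pos (Y : 'rV[R]_m.+2 -> 'rV[R]_m.+2) v : smoothV O Y ->
  (forall y, O y -> M y -> tangent_space M y (Y y)) -> tangent_space M x v ->
  pdot t ('D_v Y x) x = - pdot t (Y x) v /\
  pdot t ('D_v Y x) (L x) = - pdot t (Y x) (L v).
Proof.
move=> sY tY tv; have dY := smoothV_diff sY Ox.
have dL : differentiable L x.
  exact: smoothV_diff smoothV_normal x Ox.
split; apply/eqP; rewrite -addr_eq0; apply/eqP.
  rewrite -[in X in _ + X](derive_id x v) -derive_pdot//.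
  rewrite (@tangent_derive_eq _ _ _ M O _ (fun=> 0) x v)//.
  - by rewrite derive_cst.
  - exact: differentiable_pdot.
  - by move=> y Oy My; case/(tangentP _ My): (tY y Oy My).
rewrite -[in X in _ + X](derive_id x v) -derive_torus_op// -derive_pdot//.
rewrite (@tangent_derive_eq _ _ _ M O _ (fun=> 0) x v)//.
- by rewrite derive_cst.
- exact: differentiable_pdot.
- by move=> y Oy My; case/(tangentP _ My): (tY y Oy My).
Qed.

Local Notation q i := (pdot t (L (e i x)) (e i x)).

Lemma frame_derive_pos i :
  pdot t ('D_(e i x) (e i) x) x = - eps i /\
  pdot t ('D_(e i x) (e i) x) (L x) = - q i.
Proof.
have [-> ->] := derive_tangent_pos (frame_smooth i)
  (fun y Oy My => frame_tangent Oy My i) (frame_tangent Ox Mx i).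
by rewrite frame_dot// eqxx mulr1n (pdotC _ _ (L _)).
Qed.

(** Gauss formula for [M] in the flat ambient space: [nablaM] is the tangential part, and the other
    two terms form the second fundamental form. *)
Lemma frame_derive i : 'D_(e i x) (e i) x =
  nablaM t eps e (e i) (e i) x - (q i / (c - 1)) *: L x - eps i *: x.
Proof.
rewrite {1}(frame_decomp Ox Mx ('D_(e i x) (e i) x)).
have [-> ->] := frame_derive_pos i.
by rewrite mulNr !scaleNr.
Qed.

Lemma nablaM_tangent i : tangent_space M x (nablaM t eps e (e i) (e i) x).
Proof.
case: (frame) => _ _ /(_ x Ox Mx) -> _.
by exists (fun j => eps j * pdot t ('D_(e i x) (e i) x) (e j x)).
Qed.

Section Normal.

Variables (V : 'rV[R]_m.+2 -> 'rV[R]_m.+2) (a : R).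
Hypothesis smV : smoothV O V.
Hypothesis normV : forall y, O y -> M y -> V y = a *: L y.

(** As [X x] is tangent, [V] may be replaced by [a L], whose derivative [a L (X x)] is already
    orthogonal to the position vector. *)
Lemma nabla_normal X : tangent_space M x (X x) ->
  nabla_phi t 1 id X V x = a *: L (X x).
Proof.
move=> tX; have dI : differentiable id x by exact: ex_diff.
have dL := smoothV_diff smoothV_normal Ox.
have -> : nabla_phi t 1 id X V x =
    'D_(X x) V x - (1 * pdot t ('D_(X x) V x) x) *: x by [].
rewrite (@tangent_derive_eq _ _ _ M O V (a \*: L) x (X x))//.
- rewrite deriveZ; last exact: diff_derivable.
  rewrite (derive_torus_op _ dI) derive_id pdotZl tangent_torus_op//.
  by rewrite !mulr0 scale0r subr0.
- exact: smoothV_diff smV x Ox.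
- exact: differentiableZ.
Qed.

End Normal.

(* This is the trace of the square of the shape operator. *)
Definition torus_eigen : R := T * (c - 2) / (c - 1) + m%:R.

(** In the Gauss formula the tangential part cancels against [nablaM] and the position part against
    the projection to the sphere; only the [L x] component survives. *)
Lemma tension_normal : tension t t 1 id eps e x = - (T / (c - 1)) *: L x.
Proof.
rewrite /tension; have -> : - (T / (c - 1)) *: L x =
    \sum_(i < m) - (eps i * q i / (c - 1)) *: L x.
  by rewrite -scaler_suml sumrN -mulr_suml frame_trace.
apply: eq_bigr => i _; rewrite !dmap_id.
have -> : nabla_phi t 1 id (e i) (e i) x = 'D_(e i x) (e i) x -
  (1 * pdot t ('D_(e i x) (e i) x) x) *: x by [].
have [-> _] := frame_derive_pos i; rewrite frame_derive.
by apply/rowP => j; rewrite !mxE; ring.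
Qed.

End PointDerivatives.

(** Apply [L] to the Gauss formula for [e i]: the [nablaM] part cancels with the connection term,
    [L (L x)] gives [(c - 2) L x] plus a position part removed by the projection, and [eps i *: x]
    gives [eps i *: L x]. *)
Lemma laplacian_normal (V : 'rV[R]_m.+2 -> 'rV[R]_m.+2) (a : R) :
  smoothV O V -> (forall y, O y -> M y -> V y = a *: L y) ->
  forall x, O x -> M x ->
  rough_laplacian t t 1 id eps e V x = (a * torus_eigen) *: L x.
Proof.
move=> sV nV x Ox Mx; pose q i := pdot t (L (e i x)) (e i x).
rewrite /rough_laplacian; have -> : (a * torus_eigen) *: L x =
    - \sum_(i < m)
        (- a * (eps i * q i * (c - 2) / (c - 1) + eps i * eps i)) *: L x.
  rewrite -scaler_suml -mulr_sumr big_split /= -!mulr_suml frame_trace//.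
  rewrite (eq_bigr (fun=> 1)) => [|i _]; last exact: eps_sqr.
  by rewrite sumr_const card_ord mulNr scaleNr opprK.
congr (- _); apply: eq_bigr => i _.
rewrite (nabla_normal Ox Mx sV nV (nablaM_tangent Ox Mx i)).
have se := frame_smooth i.
(* [W] is known only along [M] as well, but it is smooth on [O] and [e i] is tangent, so the
   replacement argument applies a second time. *)
set W := nabla_phi t 1 id (e i) V.
have sW : smoothV O W by apply: smoothV_nabla => //; exact: smoothV_id.
have nW y : O y -> M y -> W y = a *: L (e i y).
  move=> Oy My; rewrite /W (nabla_normal Oy My sV nV)//.
  exact: frame_tangent.
have sL := smoothV_torus_op se; have dL := smoothV_diff sL Ox.
have -> : nabla_phi t 1 id (e i) W x =
    'D_(e i x) W x - (1 * pdot t ('D_(e i x) W x) x) *: x by [].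
rewrite (@tangent_derive_eq _ _ _ M O W (a \*: (fun y => L (e i y))) x
  (e i x))//.
- rewrite deriveZ; last exact: diff_derivable.
  rewrite derive_torus_op; last exact: smoothV_diff se x Ox.
  rewrite frame_derive// !torus_opB !torus_opZ torus_op_sqr.
  rewrite !pdotZl !pdotBl !pdotZl pdotDl !pdotZl (pdot_normal_pos Mx).
  rewrite (tangent_torus_op Mx (nablaM_tangent Ox Mx i)) (M_sphere Mx).
  by apply/rowP => j; rewrite !mxE /q; field.
- exact: frame_tangent.
- exact: smoothV_diff sW x Ox.
- exact: differentiableZ.
Qed.

(** Smoothness off [M] belongs to the induction: the value along [M] alone would not permit the next
    Laplacian. *)
Lemma laptau_normal j : smoothV O (laptau t t 1 id eps e j) /\
  forall x, O x -> M x ->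
  laptau t t 1 id eps e j x = (- (T / (c - 1)) * torus_eigen ^+ j) *: L x.
Proof.
elim: j => [|j [sj nj]]; split.
- exact: smoothV_tension.
- by move=> x Ox Mx; rewrite expr0 mulr1; exact: tension_normal.
- exact: smoothV_laplacian.
- move=> x Ox Mx; rewrite exprSr mulrA.
  exact: (laplacian_normal sj nj).
Qed.

Section TensionFields.

Variable x : 'rV[R]_m.+2.
Hypotheses (Ox : O x) (Mx : M x).

Local Notation S := torus_eigen.
Local Notation kappa := (- (T / (c - 1))).
Local Notation V j := (laptau t t 1 id eps e j).
Local Notation D := (nabla_phi t 1 id).
Local Notation Rm := (curv t 1).

Let pdot_normal_frame i : pdot t (L x) (e i x) = 0.
Proof. by rewrite pdotC; case/(tangentP _ Mx): (frame_tangent Ox Mx i). Qed.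

Let laptauE j : V j x = (kappa * S ^+ j) *: L x.
Proof. by case: (laptau_normal j) => _ ->. Qed.

Let nabla_laptau i j : D (e i) (V j) x = (kappa * S ^+ j) *: L (e i x).
Proof.
have [sV nV] := laptau_normal j.
by apply: (nabla_normal Ox Mx sV nV); exact: frame_tangent.
Qed.

Lemma curv_laptau j :
  \sum_(i < m) eps i *: Rm (V j x) (dmap id (e i) x) (dmap id (e i) x)
  = (m%:R * (kappa * S ^+ j)) *: L x.
Proof.
have -> : m%:R = \sum_(i < m) (1 : R) by rewrite sumr_const card_ord.
rewrite mulr_suml scaler_suml; apply: eq_bigr => i _.
rewrite dmap_id /curv laptauE pdotZl pdot_normal_frame frame_dot// eqxx mulr1n.
by rewrite mulr0 scale0r subr0 scale1r scalerA eps_sqr scale1r mul1r.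
Qed.

Lemma curv_nabla_laptau j j' :
  \sum_(i < m) eps i *: Rm (D (e i) (V j) x) (V j' x) (dmap id (e i) x)
  = (- T * kappa ^+ 2 * S ^+ (j + j')) *: L x.
Proof.
set K := kappa ^+ 2; rewrite -(frame_trace Ox Mx) -sumrN !mulr_suml scaler_suml.
apply: eq_bigr => i _; rewrite dmap_id /curv nabla_laptau laptauE !pdotZl.
rewrite pdot_normal_frame mulr0 scale0r sub0r scale1r scalerN !scalerA.
by rewrite -scaleNr; congr (_ *: _); rewrite /K exprD; ring.
Qed.

Lemma curv_laptau_nabla j j' :
  \sum_(i < m) eps i *: Rm (V j x) (D (e i) (V j') x) (dmap id (e i) x)
  = (T * kappa ^+ 2 * S ^+ (j + j')) *: L x.
Proof.
set K := kappa ^+ 2; rewrite -(frame_trace Ox Mx) !mulr_suml scaler_suml.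
apply: eq_bigr => i _; rewrite dmap_id /curv nabla_laptau laptauE !pdotZl.
rewrite pdot_normal_frame mulr0 scale0r subr0 scale1r !scalerA.
by congr (_ *: _); rewrite /K exprD; ring.
Qed.

(** The two curvature terms keep only [<L (e i), e i>], with opposite signs, so their difference
    doubles; the orders add up to [d] whatever [l] is, so the [s] summands are equal. *)
Lemma curv_cross_sum s d (j j' : nat -> nat) :
  (forall l, (1 <= l < s.+1)%N -> (j l + j' l = d)%N) ->
  \sum_(1 <= l < s.+1) \sum_(i < m)
      (eps i *: Rm (D (e i) (V (j l)) x) (V (j' l) x) (dmap id (e i) x)
       - eps i *: Rm (V (j l) x) (D (e i) (V (j' l)) x) (dmap id (e i) x))
  = (- (2 * s%:R) * T * kappa ^+ 2 * S ^+ d) *: L x.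
Proof.
move=> jd.
rewrite (eq_big_nat _ _ (F2 := fun=> (- 2 * T * kappa ^+ 2 * S ^+ d) *: L x)).
  rewrite sumr_const_nat subSS subn0 -scaler_nat scalerA.
  by congr (_ *: _); ring.
move=> l /jd jl; rewrite sumrB curv_nabla_laptau curv_laptau_nabla jl -scalerBl.
by congr (_ *: _); ring.
Qed.

(** The cross terms number [2(s - 1)] for [r = 2s], and [2(s - 1) + 1] for [r = 2s + 1] because of
    the unpaired last sum: [r - 2] in both cases, each with exponent [r - 3]. *)
Lemma tau_normal r : (3 <= r)%N -> tau t t 1 id eps e r x =
  (kappa * S ^+ (r - 3) * (S ^+ 2 - m%:R * S + (r%:R - 2) * T * kappa)) *: L x.
Proof.
move=> r3; rewrite /tau; have rE := odd_double_half r; set s := r./2 in rE *.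
have {r3} : (3 <= odd r + s.*2)%N by rewrite rE.
rewrite -rE oddD odd_double addbF oddb; move: s {rE} => s.
case: (odd r) => s3 /=.
(* The bound on [r] leaves [s >= 1] here and [s >= 2] in the even case, so that no natural
   subtraction truncates. *)
- case: s s3 => [//|s] _.
  rewrite /tau_odd laptauE curv_laptau curv_nabla_laptau.
  rewrite (@curv_cross_sum _ s.*2) => [|l ls]; last by lia.
  rewrite -3!scalerBl; congr (_ *: _).
  have -> : (2 * s.+1 = s.*2.+2)%N by lia.
  have -> : (s.*2.+2 - 1 = s.*2.+1)%N by lia.
  have -> : (s.+1 - 1 + (s.+1 - 1) = s.*2)%N by lia.
  have -> : (1 + s.+1.*2 - 3 = s.*2)%N by lia.
  have -> : ((1 + s.+1.*2)%:R : R) = 3 + 2 * s%:R.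
    by rewrite -muln2 natrD natrM -natr1; ring.
  by rewrite !exprS; ring.
- case: s s3 => [//|[//|s]] _; rewrite /tau_even laptauE curv_laptau.
  rewrite (@curv_cross_sum _ s.*2.+1) => [|l ls]; last by lia.
  rewrite -2!scalerBl; congr (_ *: _).
  have -> : (2 * s.+2 - 1 = s.*2.+3)%N by lia.
  have -> : (2 * s.+2 - 2 = s.*2.+2)%N by lia.
  have -> : (0 + s.+2.*2 - 3 = s.*2.+1)%N by lia.
  have -> : ((0 + s.+2.*2)%:R : R) = 4 + 2 * s%:R.
    by rewrite add0n -muln2 natrM -!natr1; ring.
  by rewrite !exprS -natr1; ring.
Qed.

End TensionFields.

(** At each point [eta] is a multiple [b] of [L x], being orthogonal to [x] and to [M]; [b] is
    nonzero because [<eta, eta> = epsn]. *)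
Lemma mean_curvature_normal epsn eta x : O x -> M x ->
  unit_normal t 1 M O epsn eta ->
  exists2 a, a != 0 & mean_curvature t 1 eps e epsn eta x = m%:R^-1 * (a * T).
Proof.
move=> Ox Mx [epsn1 /(smooth_onV openO) seta uN].
have deta := smoothV_diff seta Ox.
have [etaS etaT eta1] := uN x Ox Mx.
have eta_pos := pseudosphere_tangent etaS.
have etaE : eta x = (pdot t (eta x) (L x) / (c - 1)) *: L x.
  rewrite {1}(frame_decomp Ox Mx (eta x)) eta_pos scale0r addr0.
  rewrite big1 ?add0r// => j _.
  by rewrite etaT ?mulr0 ?scale0r//; exact: frame_tangent.
set b := _ / (c - 1) in etaE.
exists (- (epsn * b)).
  have epsn0 : epsn != 0 by case: epsn1 => ->; rewrite ?oppr_eq0 oner_neq0.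
  rewrite oppr_eq0 mulf_neq0//; apply: contra_neq epsn0 => b0.
  by rewrite -eta1 etaE b0 scale0r pdot0l.
rewrite /mean_curvature -mulrA mulNr -mulrA -mulrN; congr (_ * (_ * _)).
rewrite -(frame_trace Ox Mx) -mulrN -sumrN mulr_sumr; apply: eq_bigr => i _.
have -> : shape_operator t 1 eta (e i) x =
  - ('D_(e i x) eta x - (1 * pdot t ('D_(e i x) eta x) x) *: x) by [].
have se := smoothV_diff (frame_smooth i) Ox.
(* Differentiating [<eta, e i> = 0] moves the derivative onto the frame, so the dependence of [b] on
   the point never enters. *)
have : pdot t ('D_(e i x) eta x) (e i x)
    + pdot t (eta x) ('D_(e i x) (e i) x) = 0.
  rewrite -derive_pdot//.
  rewrite (@tangent_derive_eq _ _ _ M O _ (fun=> 0) x (e i x))//.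
  - by rewrite derive_cst.
  - exact: frame_tangent.
  - exact: differentiable_pdot.
  - move=> y Oy My; have [_ + _] := uN y Oy My; apply; exact: frame_tangent.
rewrite {1}etaE pdotZl (pdotC _ (L x)); have [_ ->] := frame_derive_pos Ox Mx i.
rewrite pdotNl pdotBl pdotZl.
have /(tangentP _ Mx)[+ _] := frame_tangent Ox Mx i.
rewrite (pdotC _ x) => ->; rewrite mulr0 subr0 => H.
move/eqP : H; rewrite addr_eq0 => /eqP ->; ring.
Qed.

End Frame.

End CliffordHypersurface.

(** * Local orthonormal frames *)

Section Reflection.

Variables (R : realType) (n t : nat).
Implicit Types (u v w : 'rV[R]_n).

Definition refl w v : 'rV[R]_n := v - (2 * pdot t v w / pdot t w w) *: w.

Lemma reflD w u v : refl w (u + v) = refl w u + refl w v.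
Proof. by rewrite /refl pdotDl; apply/rowP => j; rewrite !mxE; ring. Qed.

Lemma reflZ w a v : refl w (a *: v) = a *: refl w v.
Proof. by rewrite /refl pdotZl; apply/rowP => j; rewrite !mxE; ring. Qed.

Lemma refl_sum w m (F : 'I_m -> 'rV[R]_n) :
  refl w (\sum_(i < m) F i) = \sum_(i < m) refl w (F i).
Proof.
elim/big_rec2 : _ => [|i a b _ <-]; last exact: reflD.
by rewrite -(scale0r (0 : 'rV_n)) reflZ !scale0r.
Qed.

Lemma refl_id w v : pdot t v w = 0 -> refl w v = v.
Proof. by move=> vw; rewrite /refl vw mulr0 mul0r scale0r subr0. Qed.

Lemma pdot_refl w u v : pdot t w w != 0 ->
  pdot t (refl w u) (refl w v) = pdot t u v.
Proof.
move=> w0; rewrite /refl !pdotBl !pdotBr !pdotZl !pdotZr (pdotC _ w v).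
by field.
Qed.

Lemma reflK w v : pdot t w w != 0 -> refl w (refl w v) = v.
Proof.
move=> w0; rewrite /refl pdotBl pdotZl; apply/rowP => j; rewrite !mxE.
by field.
Qed.

(** Equal squares give [<u - v, u - v> = - 2 <v, u - v>], so the reflection adds exactly [u - v] to
    [v]. *)
Lemma refl_swap u v : pdot t u u = pdot t v v -> pdot t (u - v) (u - v) != 0 ->
  refl (u - v) v = u.
Proof.
rewrite /refl !pdotBl !pdotBr (pdotC _ v u) => -> w0.
by apply/rowP => j; rewrite !mxE; field; move: w0; congr (_ != 0); ring.
Qed.

Lemma smoothV_refl p (O : set 'rV[R]_p) (W V : 'rV[R]_p -> 'rV[R]_n) :
  open O -> (forall x, O x -> pdot t (W x) (W x) != 0) ->
  smoothV O W -> smoothV O V -> smoothV O (fun x => refl (W x) (V x)).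
Proof.
move=> oO W0 sW sV; apply: smoothVB => //; apply: smoothVZ => //.
apply: smoothRM => //; last by apply: smoothRV => //; exact: smoothR_pdot.
by apply: smoothRM => //; [exact: smoothR_cst|exact: smoothR_pdot].
Qed.

End Reflection.

Section FrameExistence.

Variables (R : realType) (m k t : nat) (c : R) (A : pred 'I_m.+2).
Variable M : set 'rV[R]_m.+2.
Hypothesis c_gt1 : 1 < c.
Hypothesis M_sphere : forall x, M x -> pdot t x x = 1.
Hypothesis M_factor : forall x, M x -> pdot t (proj A x) x = c^-1.
Hypothesis M_tangent : forall x v, M x ->
  tangent_space M x v <-> pdot t v x = 0 /\ pdot t (proj A v) x = 0.
Variables a0 b0 : 'I_m.+2.
Hypotheses (Aa0 : A a0) (Ab0 : ~~ A b0) (ta0 : (t <= a0)%N) (tb0 : (t <= b0)%N).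

Implicit Types (x v w y : 'rV[R]_m.+2).

Local Notation b j := (delta_mx 0 j : 'rV[R]_m.+2).
Local Notation Q x := (x - proj A x).

Let c_gt0 : 0 < c. Proof. exact: lt_trans c_gt1. Qed.
Let c1_gt0 : 0 < c - 1. Proof. by rewrite subr_gt0. Qed.

Let pdot_b i j : pdot t (b i) (b j) = (-1) ^+ (i < t)%N *+ (i == j).
Proof. by rewrite pdot_delta mxE eqxx /= eq_sym mulr_natr. Qed.

Let pdot_Q x : M x -> pdot t (Q x) (Q x) = (c - 1) / c.
Proof.
move=> Mx; rewrite pdotBl !pdotBr pdot_proj (pdotC _ x) M_factor// M_sphere//.
by field; rewrite gt_eqF.
Qed.

Let pdot_P x : M x -> pdot t (proj A x) (proj A x) = c^-1.
Proof. by move=> Mx; rewrite pdot_proj M_factor. Qed.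

Let pdot_PQ x y : pdot t (proj A x) (Q y) = 0.
Proof. by rewrite pdotBr pdot_proj subrr. Qed.

(** The square is [2 - 2 s <u, v>]: [s = 1] works unless [<u, v> = 1], and then [s = -1] gives 4. *)
Lemma exists_sign (u v : 'rV[R]_m.+2) : pdot t u u = 1 -> pdot t v v = 1 ->
  exists2 s : R, s * s = 1 & pdot t (s *: u - v) (s *: u - v) != 0.
Proof.
move=> uu vv.
have E s : s * s = 1 ->
    pdot t (s *: u - v) (s *: u - v) = 2 - 2 * s * pdot t u v.
  move=> ss; rewrite !pdotBl !pdotBr !pdotZl !pdotZr uu vv (pdotC _ v u) mulr1.
  by rewrite ss; ring.
have [uv|uv] := eqVneq (pdot t u v) 1.
  exists (-1); first by rewrite mulrNN mulr1.
  by rewrite E ?mulrNN ?mulr1// uv (_ : _ - _ = 4) ?pnatr_eq0//; ring.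
exists 1; first by rewrite mulr1.
rewrite E ?mulr1// -{1}(mulr1 2) -mulrBr mulf_neq0 ?pnatr_eq0//.
by rewrite subr_eq0 eq_sym.
Qed.

(* Two orthogonal reflections, which depend on x, exchange a coordinate vector
   of each factor with the normalised component of x in that factor, up to sign;
   they map the remaining coordinate vectors to a frame of the torus at x. The
   signs keep the reflections nondegenerate near x0. *)
Lemma exists_orthonormal_frame x0 : M x0 -> exists O eps e,
  [/\ open O, O x0 & orthonormal_frame t M O (eps : 'I_m -> R) e].
Proof.
(* [nu] and [mu] are the reciprocal lengths of the two factor components, of squares [1 / c] and
   [(c - 1) / c]. Both are space-like, hence can be matched with the space-like [b a0] and
   [b b0]. *)
move=> Mx0; set nu := Num.sqrt c; set mu := Num.sqrt (c / (c - 1)).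
have nu2 : nu * nu = c by rewrite -expr2 sqr_sqrtr// ltW.
have mu2 : mu * mu = c / (c - 1) by rewrite -expr2 sqr_sqrtr// ltW// divr_gt0.
have nu0 : nu != 0 by rewrite gt_eqF// sqrtr_gt0.
have mu0 : mu != 0 by rewrite gt_eqF// sqrtr_gt0 divr_gt0.
have nuP x : M x -> pdot t (nu *: proj A x) (nu *: proj A x) = 1.
  by move=> Mx; rewrite pdotZl pdotZr mulrA nu2 pdot_P// divff ?gt_eqF.
have muQ x : M x -> pdot t (mu *: Q x) (mu *: Q x) = 1.
  move=> Mx; rewrite pdotZl pdotZr mulrA mu2 pdot_Q//.
  by field; rewrite !gt_eqF.
have ba : pdot t (b a0) (b a0) = 1 by rewrite pdot_b eqxx ltnNge ta0.
have bb : pdot t (b b0) (b b0) = 1 by rewrite pdot_b eqxx ltnNge tb0.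
have [s s2 ws0] := exists_sign (nuP x0 Mx0) ba.
have [s' s'2 ws'0] := exists_sign (muQ x0 Mx0) bb.
pose w1 x := s *: (nu *: proj A x) - b a0.
pose w2 x := s' *: (mu *: Q x) - b b0.
pose O := [set x | pdot t (w1 x) (w1 x) != 0]
  `&` [set x | pdot t (w2 x) (w2 x) != 0].
have sP (U : set 'rV[R]_m.+2) : open U -> smoothV U (fun x => proj A x).
  by move=> oU; apply: (@smoothV_proj _ _ _ _ _ id) => //; exact: smoothV_id.
have sw1 U : open U -> smoothV U w1.
  move=> oU; apply: smoothVB => //; last exact: smoothV_cst.
  apply: smoothVZ => //; first exact: smoothR_cst.
  by apply: smoothVZ => //; [exact: smoothR_cst|exact: sP].
have sw2 U : open U -> smoothV U w2.
  move=> oU; apply: smoothVB => //; last exact: smoothV_cst.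
  apply: smoothVZ => //; first exact: smoothR_cst.
  apply: smoothVZ => //; first exact: smoothR_cst.
  by apply: smoothVB => //; [exact: smoothV_id|exact: sP].
have oneq (w : 'rV[R]_m.+2 -> 'rV[R]_m.+2) :
    smoothV setT w -> open [set x | pdot t (w x) (w x) != 0].
  move=> sw.
  apply: (@open_comp _ _ (fun x => pdot t (w x) (w x)) [set z | z != 0]).
    move=> x _; have dw := smoothV_diff sw (I : setT x).
    exact/differentiable_continuous/differentiable_pdot.
  exact: open_neq.
have openO : open O.
  by apply: openI; apply: oneq; [apply: sw1|apply: sw2]; exact: openT.
have a0b0 : a0 != b0 by apply: contra Ab0 => /eqP <-.
(* Two successive lifts let [iota] enumerate the indices other than [a0] and [b0]. *)
have [b' b'E] : exists b', b0 = lift a0 b'.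
  by case: (unlift_some a0b0) => b' -> _; exists b'.
pose iota i : 'I_m.+2 := lift a0 (lift b' i).
pose H x v := refl t (w2 x) (refl t (w1 x) v).
exists O, (fun i => (-1) ^+ (iota i < t)%N), (fun i x => H x (b (iota i))).
have HD x u v : H x (u + v) = H x u + H x v by rewrite /H !reflD.
have HH x u v : O x -> pdot t (H x u) (H x v) = pdot t u v.
  by case=> n1 n2; rewrite /H !pdot_refl.
have Hsum x (u : 'I_m -> R) :
    H x (\sum_(i < m) u i *: b (iota i)) = \sum_(i < m) u i *: H x (b (iota i)).
  by rewrite /H !refl_sum; apply: eq_bigr => i _; rewrite !reflZ.
(* Each reflection acts inside its own factor: [w1 x] is orthogonal to [w2 x], so the second one
   fixes what the first produces. *)
have Ha x : O x -> M x -> H x (b a0) = s *: (nu *: proj A x).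
  move=> [n1 n2] Mx; rewrite /H /w1 refl_swap//.
    rewrite refl_id// !pdotZl /w2 pdotBr !pdotZr pdot_PQ.
    rewrite proj_sym proj_delta (negbTE Ab0) pdotC pdot0l.
    by rewrite !mulr0 subrr !mulr0.
  by rewrite pdotZl pdotZr mulrA s2 nuP// mul1r ba.
have Hb x : O x -> M x -> H x (b b0) = s' *: (mu *: Q x).
  move=> [n1 n2] Mx; rewrite /H [refl t (w1 x) _]refl_id.
    by rewrite /w2 refl_swap// pdotZl pdotZr mulrA s'2 muQ// mul1r bb.
  rewrite /w1 pdotBr !pdotZr pdot_b (eq_sym b0) (negbTE a0b0) mulr0n subr0.
  by rewrite -proj_sym proj_delta (negbTE Ab0) pdot0l !mulr0.
have s0 : s != 0.
  by apply/eqP => s0; move/eqP: s2; rewrite s0 mulr0 eq_sym oner_eq0.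
have s'0 : s' != 0.
  by apply/eqP => s'0; move/eqP: s'2; rewrite s'0 mulr0 eq_sym oner_eq0.
have tE x v : M x -> tangent_space M x v <->
    pdot t v (proj A x) = 0 /\ pdot t v (Q x) = 0.
  move=> Mx; apply: iff_trans (M_tangent v Mx) _.
  rewrite pdotBr proj_sym; split=> -[h1 h2]; split=> //.
    by rewrite h1 h2 subrr.
  by move/eqP : h2; rewrite h1 subr0 => /eqP.
have iota_a i : (iota i == a0) = false by apply/negbTE; rewrite eq_sym neq_lift.
have iota_b i : (iota i == b0) = false.
  by apply/negbTE; rewrite b'E (inj_eq lift_inj) eq_sym neq_lift.
split; [exact: openO|by split|split].
- by move=> i; case: (_ < _)%N; [right|left].
- move=> i; apply: (smoothV_on openO).
  apply: smoothV_refl => //; [by move=> x []|exact: sw2|].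
  apply: smoothV_refl => //; [by move=> x []|exact: sw1|exact: smoothV_cst].
- move=> x Ox Mx; apply/seteqP; split=> v.
    move=> /(tE _ _ Mx)[v1 v2].
    (* The preimage of [v] under [H x]. As [H x] is an isometry, orthogonality of [v] to both
       components of [x] kills the coordinates of [u] at [a0] and [b0]. *)
    pose u := refl t (w1 x) (refl t (w2 x) v).
    have Hu : H x u = v by rewrite /H /u; case: Ox => n1 n2; rewrite !reflK.
    have ua : u 0 a0 = 0.
      have : pdot t (H x u) (H x (b a0)) = 0.
        by rewrite Hu Ha// !pdotZr v1 !mulr0.
      by rewrite HH// pdotC pdot_delta ltnNge ta0 mul1r.
    have ub : u 0 b0 = 0.
      have : pdot t (H x u) (H x (b b0)) = 0.
        by rewrite Hu Hb// !pdotZr v2 !mulr0.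
      by rewrite HH// pdotC pdot_delta ltnNge tb0 mul1r.
    exists (fun i => u 0 (iota i)); rewrite -Hsum -Hu; congr (H x _).
    rewrite [LHS]row_sum_delta (bigD1_ord a0)//= ua scale0r add0r.
    by rewrite (bigD1_ord b')//= -b'E ub scale0r add0r.
  move=> [u ->]; apply/(tE _ _ Mx); rewrite !pdot_suml.
  split; apply: big1 => i _; rewrite pdotZl.
    have : pdot t (H x (b (iota i))) (H x (b a0)) = 0.
      by rewrite HH// pdot_b iota_a.
    rewrite Ha// !pdotZr => /eqP; rewrite !mulf_eq0 (negbTE s0) (negbTE nu0) /=.
    by move=> /eqP ->; rewrite mulr0.
  have : pdot t (H x (b (iota i))) (H x (b b0)) = 0.
    by rewrite HH// pdot_b iota_b.
  rewrite Hb// !pdotZr => /eqP; rewrite !mulf_eq0 (negbTE s'0) (negbTE mu0) /=.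
  by move=> /eqP ->; rewrite mulr0.
- by move=> x Ox Mx i j; rewrite HH// pdot_b /iota !(inj_eq lift_inj).
Qed.

End FrameExistence.

(** * The torus and its components *)

Section TorusIndex.

Variables (m t k l : nat).
Hypotheses (lk : (l <= k)%N) (lt : (l <= t)%N).
Hypotheses (tlmk : (t - l <= m - k)%N) (km : (k <= m)%N).

Definition torus_index (i : 'I_m.+2) : bool :=
  (i < l)%N || (t <= i < t + (k - l) + 1)%N.

Lemma card_torus_index : #|torus_index| = k.+1.
Proof.
pose B i := (i < l)%N || (t <= i < t + (k - l) + 1)%N.
have -> : #|torus_index| = count B (iota 0 m.+2).
  rewrite -val_enum_ord count_map enumT cardE /enum_mem size_filter.
  exact: eq_count.
(* Four consecutive blocks: time-like then space-like, each split between the factors; the first and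
   third lie in the index set, of total size [l + (k - l + 1)]. *)
have -> : m.+2 = (l + ((t - l) + ((k - l).+1 + (m.+2 - (t + (k - l) + 1)))))%N.
  by lia.
have countT p n : (forall i, (p <= i < p + n)%N -> B i) ->
    count B (iota p n) = n.
  move=> H; rewrite -[RHS](size_iota p); apply/eqP; rewrite -all_count.
  by apply/allP => i; rewrite mem_iota => /H.
have countF p n : (forall i, (p <= i < p + n)%N -> ~~ B i) ->
    count B (iota p n) = 0%N.
  move=> H; apply/eqP; rewrite -leqn0 leqNgt -has_count; apply/hasPn => i.
  by rewrite mem_iota => /H.
rewrite !iotaD !count_cat countT => [|i]; last by rewrite /B; lia.
rewrite countF => [|i]; last by rewrite /B; lia.
rewrite countT => [|i]; last by rewrite /B; lia.
by rewrite countF => [|i]; [lia|rewrite /B; lia].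
Qed.

End TorusIndex.

Section Torus.

Variables (R : realType) (m t k l : nat) (c : R).
Hypotheses (c_gt1 : 1 < c) (lk : (l <= k)%N) (lt : (l <= t)%N).

Local Notation A := (@torus_index m t k l).
Local Notation Tor := (pseudo_Clifford_torus t k l c : set 'rV[R]_m.+2).

Let c_neq0 : c != 0. Proof. by rewrite gt_eqF// (lt_trans ltr01). Qed.

(** The two factor equations add up to the sphere equation, as [1 / c + (c - 1) / c = 1]. *)
Lemma torusP (x : 'rV[R]_m.+2) :
  Tor x <-> pdot t x x = 1 /\ pdot t (proj A x) x = c^-1.
Proof.
have E2 : - (\sum_(i < m.+2 | (i < l)%N) x 0 i ^+ 2)
     + \sum_(i < m.+2 | (t <= i < t + (k - l) + 1)%N) x 0 i ^+ 2
     = pdot t (proj A x) x.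
  rewrite pdot_proj_diag -sumrN [X in X + _]big_mkcond [X in _ + X]big_mkcond.
  rewrite -big_split [RHS]big_mkcond; apply: eq_bigr => i _ /=.
  rewrite /torus_index; case: (ltnP i l) => [il|li] /=.
    have it : (i < t)%N by lia.
    by rewrite it (leqNgt t i) it /= addr0 expr1 mulN1r.
  rewrite add0r; case: (leqP t i) => //= ti.
  by rewrite expr0 mul1r.
have E3 : - (\sum_(i < m.+2 | (l <= i < t)%N) x 0 i ^+ 2)
     + \sum_(i < m.+2 | (t + (k - l) + 1 <= i)%N) x 0 i ^+ 2
     = pdot t x x - pdot t (proj A x) x.
  rewrite -pdotBl pdotE -sumrN [X in X + _]big_mkcond [X in _ + X]big_mkcond.
  rewrite -big_split; apply: eq_bigr => i _ /=.
  rewrite !mxE /torus_index; case: (ltnP i l) => [il|li] /=.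
    have -> : (t + (k - l) + 1 <= i)%N = false by apply/negbTE; lia.
    by rewrite subrr mul0r mulr0 addr0.
  case: (ltnP i t) => [it|ti] /=.
    have -> : (t + (k - l) + 1 <= i)%N = false by apply/negbTE; lia.
    by rewrite addr0 subr0 expr1 mulN1r expr2.
  rewrite add0r expr0 mul1r; case: ltnP => /= _.
    by rewrite subrr mul0r.
  by rewrite subr0 expr2.
rewrite /pseudo_Clifford_torus /= E2 E3 /pseudosphere /= !div1r invr1.
split=> [[-> -> _]//|[-> ->]]; split=> //.
by field.
Qed.

Hypotheses (tlmk : (t - l <= m - k)%N) (km : (k <= m)%N).

Lemma torus_nonempty : exists x, Tor x.
Proof.
(* [a0] and [b0] are the last coordinates of the two factors; both are space-like, so positive
   squares can be prescribed on them. *)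
have i1 : (t + (k - l) < m.+2)%N by lia.
pose a0 := Ordinal i1; pose b0 : 'I_m.+2 := ord_max.
have Aa0 : A a0 by rewrite /torus_index /=; lia.
have Ab0 : A b0 = false by rewrite /torus_index /=; lia.
have c0 : 0 <= c by rewrite ltW// (lt_trans ltr01).
have u2 : Num.sqrt c^-1 * Num.sqrt c^-1 = c^-1.
  by rewrite -expr2 sqr_sqrtr// invr_ge0.
have v2 : Num.sqrt (1 - c^-1) * Num.sqrt (1 - c^-1) = 1 - c^-1.
  by rewrite -expr2 sqr_sqrtr// subr_ge0 invf_le1 ?ltW// (lt_trans ltr01).
exists (Num.sqrt c^-1 *: delta_mx 0 a0 + Num.sqrt (1 - c^-1) *: delta_mx 0 b0).
have ab : (a0 == b0) = false by apply/eqP => ab; rewrite ab Ab0 in Aa0.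
apply/torusP; rewrite projD !projZ !proj_delta Aa0 Ab0 scaler0 addr0.
rewrite !pdotDl !pdotDr !pdotZl !pdotZr !pdot_delta !mxE !eqxx ab.
rewrite (eq_sym b0) ab /=.
have -> : (t + (k - l) < t)%N = false by lia.
have -> : (m.+1 < t)%N = false by lia.
by rewrite !mul1r !(mulr0, mulr1, addr0, add0r) u2 v2 subrKC.
Qed.

End Torus.

(** * Tangent spaces of the torus and of its components *)

Section Curves.

Variables (R : realType) (n t : nat).
Implicit Types (x v : 'rV[R]_n).

Lemma proj_conic (A : pred 'I_n) a x v s :
  proj A (conic a x v s) = conic a (proj A x) (proj A v) s.
Proof. by rewrite /conic projD !projZ. Qed.

(** This is [(1 - a s^2)^2 + 4 a s^2 = (1 + a s^2)^2]. *)
Lemma pdot_conic a x v s : pdot t v x = 0 -> pdot t v v = 4 * a * pdot t x x ->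
  1 + a * s ^+ 2 != 0 ->
  pdot t (conic a x v s) (conic a x v s) = pdot t x x.
Proof.
move=> vx vv nz; rewrite /conic pdotDl !pdotDr !pdotZl !pdotZr.
by rewrite (pdotC _ x v) vx vv; field.
Qed.

End Curves.

Lemma tangent_pseudosphere (R : realType) (n t : nat) (x v : 'rV[R]_n.+1) :
  pdot t x x = 1 -> pdot t v x = 0 -> tangent_space (pseudosphere t 1) x v.
Proof.
move=> xx vx; exists (conic (pdot t v v / 4) x v); split.
- exact: conic0.
- near=> s; rewrite /pseudosphere /= pdot_conic ?xx ?divr1//; first by field.
  by near: s; exact: near_conic.
- exact: derive_conic.
Unshelve. all: by end_near. Qed.

(** The image of a small interval is connected, contains [g 0] and lies in [X]. Hence passing to a
    component loses no tangent vector. *)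
Lemma component_curve (R : realType) (T : topologicalType) (X : set T) x0
    (g : R -> T) :
  connected_component X x0 (g 0) ->
  (\forall s \near (0 : R), {for s, continuous g}) ->
  (\forall s \near (0 : R), X (g s)) ->
  \forall s \near (0 : R), connected_component X x0 (g s).
Proof.
move=> Xg gc gX.
have : \forall s \near (0 : R), {for s, continuous g} /\ X (g s).
  by near=> s; split; near: s.
case/nbhs_ballP => d /= d0 dgX.
have -> := same_connected_component Xg.
have B0 : (ball (0 : R) d) 0 by exact: ballxx.
have sub : g @` ball (0 : R) d `<=` connected_component X (g 0).
  apply: connected_component_max.
  - by exists 0.
  - by move=> _ [s /dgX[_ +] <-].
  - apply: connected_continuous_connected.
      apply/connected_intervalP; rewrite ball_itv.
      exact: interval_is_interval.
    apply: continuous_in_subspaceT => s; rewrite inE => /dgX[+ _]; exact.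
apply/nbhs_ballP; exists d => // s sB; apply: sub; by exists s.
Unshelve. all: by end_near. Qed.

Section TorusComponent.

Variables (R : realType) (m t k l : nat) (c : R) (M : set 'rV[R]_m.+2).
Hypotheses (c_gt1 : 1 < c) (lk : (l <= k)%N) (lt : (l <= t)%N).

Local Notation A := (@torus_index m t k l).
Local Notation Tor := (pseudo_Clifford_torus t k l c : set 'rV[R]_m.+2).

Hypothesis hM : M = Tor \/
  exists2 x : 'rV[R]_m.+2, Tor x & M = connected_component Tor x.

Let c_neq0 : c != 0. Proof. by rewrite gt_eqF// (lt_trans ltr01). Qed.
Let c1_neq0 : c - 1 != 0. Proof. by rewrite subr_eq0 gt_eqF. Qed.

Lemma component_torus x : M x -> pdot t x x = 1 /\ pdot t (proj A x) x = c^-1.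
Proof.
move=> Mx; apply/(torusP c_gt1 lk lt).
by case: hM Mx => [->//|[y _ ->]]; exact: connected_component_sub.
Qed.

Lemma component_torus_curve (g : R -> 'rV[R]_m.+2) : M (g 0) ->
  (\forall s \near (0 : R), {for s, continuous g}) ->
  (\forall s \near (0 : R), Tor (g s)) -> \forall s \near (0 : R), M (g s).
Proof.
by case: hM => [-> //|[y _ ->]]; exact: component_curve.
Qed.

(** One inclusion differentiates the two equations. For the other, a conic is run in each factor
    separately, so that both squares stay constant. *)
Lemma component_torus_tangent x v : M x ->
  tangent_space M x v <-> pdot t v x = 0 /\ pdot t (proj A v) x = 0.
Proof.
move=> Mx; have dI : differentiable (@id 'rV[R]_m.+2) x by exact: ex_diff.
have dP := differentiable_proj A dI.
have [xx Px] := component_torus Mx; split=> [tv|[vx Pvx]].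
  have derive_const (F : 'rV[R]_m.+2 -> R) a : differentiable F x ->
      (forall y, M y -> F y = a) -> 'D_v F x = 0.
    move=> dF Fa; rewrite (@tangent_derive_eq _ _ _ M setT F (fun=> a) x v)//.
    - by rewrite derive_cst.
    - exact: openT.
    - by move=> y _; exact: Fa.
  split; apply/eqP.
    have := derive_const (fun y => pdot t (id y) (id y)) 1.
    rewrite derive_pdot// derive_id (pdotC _ x) -mulr2n => /(_ _ _)/eqP.
    rewrite mulrn_eq0 /=; apply; first exact: differentiable_pdot.
    by move=> y /component_torus[].
  have := derive_const (fun y => pdot t (proj A (id y)) (id y)) c^-1.
  rewrite derive_pdot// derive_proj// derive_id proj_sym pdotC -mulr2n.
  move=> /(_ _ _)/eqP; rewrite mulrn_eq0 /=; apply.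
    exact: differentiable_pdot.
  by move=> y /component_torus[].
pose px := proj A x; pose qx := x - px; pose pv := proj A v; pose qv := v - pv.
(* The conic parameter [<v, v> / (4 <x, x>)] in each factor, where [<x, x>] is [1 / c] and
   [(c - 1) / c]. *)
pose a := c * pdot t pv pv / 4; pose b := c / (c - 1) * pdot t qv qv / 4.
pose g s := conic a px pv s + conic b qx qv s.
have g0 : g 0 = x by rewrite /g !conic0 addrC subrK.
have Pq y : proj A (y - proj A y) = 0 by rewrite projB projK subrr.
have near0 : \forall s \near (0 : R),
    1 + a * s ^+ 2 != 0 /\ 1 + b * s ^+ 2 != 0.
  by near=> s; split; near: s; exact: near_conic.
exists g; split => //.
  apply: component_torus_curve; first by rewrite g0.
    apply: filterS near0 => s [na nb].
    by apply: differentiable_continuous; apply: differentiableD;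
      exact: differentiable_conic.
  apply: filterS near0 => s [na nb].
  apply/(torusP c_gt1 lk lt).
  have pxx : pdot t px px = c^-1 by rewrite pdot_proj.
  have pvx : pdot t pv px = 0 by rewrite pdot_proj.
  have qxx : pdot t qx qx = 1 - c^-1.
    by rewrite pdotBl !pdotBr pxx (pdotC _ x) xx Px subrr subr0.
  have qvx : pdot t qv qx = 0.
    by rewrite pdotBl !pdotBr pvx vx Pvx -proj_sym Pvx !subrr.
  have Pg : proj A (g s) = conic a px pv s.
    rewrite projD !proj_conic !Pq !projK /conic !scaler0 !addr0.
    by [].
  have gg : pdot t (conic a px pv s) (conic a px pv s) = c^-1.
    by rewrite pdot_conic ?pxx//; rewrite /a; field.
  have qq : pdot t (conic b qx qv s) (conic b qx qv s) = 1 - c^-1.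
    by rewrite pdot_conic ?qxx//; rewrite /b; field; exact/andP.
  have pq : pdot t (conic a px pv s) (conic b qx qv s) = 0.
    by rewrite -Pg proj_sym proj_conic !Pq /conic !scaler0 addr0 pdotC pdot0l.
  rewrite Pg /g.
  move: (conic a px pv s) (conic b qx qv s) gg qq pq => u w uu ww uw.
  by rewrite pdotDl !pdotDr (pdotC _ w u) uw uu ww; split; ring.
have -> : v = pv + qv by rewrite addrC subrK.
by apply: is_deriveD; exact: derive_conic.
Unshelve. all: by end_near. Qed.

End TorusComponent.

(* M is the torus itself or, when the torus is not connected and a connected
   hypersurface is wanted, any one of its connected components. *)
Theorem theorem3p11 (R : realType) (r m t k l : nat) (c : R)
    (M : set 'rV[R]_m.+2)
    (hr : (3 <= r)%N) (hm : (2 <= m)%N) (ht : (1 <= t <= m)%N)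
    (hc : 1 < c) (hk : (1 <= k <= m - 1)%N)
    (hlk : (l <= k)%N) (hlt : (l <= t)%N) (htl : (t - l <= m - k)%N)
    (hM : M = pseudo_Clifford_torus t k l c \/
          exists2 x : 'rV[R]_m.+2, pseudo_Clifford_torus t k l c x &
            M = connected_component (pseudo_Clifford_torus t k l c) x) :
  proper_r_harmonic t 1 M r <->
  c <> m%:R / k%:R /\
  k%:R * c ^+ 3 - k%:R * (r%:R + 2) * c ^+ 2
    + (m%:R * (r%:R - 1) + k%:R * (r%:R + 2)) * c - m%:R * r%:R = 0.
Proof.
set P3 := _ - m%:R * r%:R.
have km : (k <= m)%N by lia.
have k0 : (k%:R : R) != 0 by rewrite pnatr_eq0; lia.
have m0 : (m%:R : R) != 0 by rewrite pnatr_eq0; lia.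
have c1 : c - 1 != 0 by rewrite subr_eq0 gt_eqF.
set A := @torus_index m t k l.
have cardA : #|A| = k.+1 by exact: card_torus_index.
have M_sphere x : M x -> pdot t x x = 1.
  by move=> /(component_torus hc hlk hlt hM)[].
have M_factor x : M x -> pdot t (proj A x) x = c^-1.
  by move=> /(component_torus hc hlk hlt hM)[].
have M_tangent x v : M x ->
    tangent_space M x v <-> pdot t v x = 0 /\ pdot t (proj A v) x = 0.
  exact: (component_torus_tangent hc hlk hlt hM).
have [x0 Mx0] : exists x, M x.
  case: hM => [->|[y Ty ->]]; first exact: torus_nonempty.
  by exists y; exact: connected_component_refl.
set T := torus_trace m k c; set S := torus_eigen m k c.
have TP : T = 0 <-> c = m%:R / k%:R.
  rewrite /T /torus_trace; split=> [/eqP|->]; last by field.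
  by rewrite subr_eq0 => /eqP <-; field.
have S0 : S != 0.
  (* [(c - 1) S] is the trace of [L^2] on the tangent space, with eigenvalues [(c - 1)^2] and 1 of
     multiplicities [k] and [m - k]. *)
  have -> : S = (k%:R * (c - 1) ^+ 2 + (m - k)%:R) / (c - 1).
    by rewrite /S /torus_eigen /torus_trace natrB//; field.
  rewrite mulf_neq0 ?invr_eq0// gt_eqF// ltr_wpDr ?ler0n//.
  by rewrite mulr_gt0 ?ltr0n ?exprn_gt0 ?subr_gt0//; lia.
have tauE O (eps : 'I_m -> R) e (oO : open O)
    (fr : orthonormal_frame t M O eps e) x :
    O x -> M x -> tau t t 1 id eps e r x =
      (- (S ^+ (r - 3) / (c - 1) ^+ 3) * T ^+ 2 * P3) *: torus_op c A x.
  move=> Ox Mx.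
  rewrite (tau_normal hc cardA M_sphere M_factor M_tangent oO fr Ox Mx hr).
  congr (_ *: _); rewrite -/T -/S.
  (* Since [S - m = T (c - 2) / (c - 1)], the bracket of [tau_normal] is [T / (c - 1)] times
     [S (c - 2) - (r - 2) T], and the latter is [P3 / (c - 1)]. *)
  set s := S ^+ _; rewrite /P3 /S /torus_eigen -/T /T /torus_trace.
  by field.
have normal0 x : M x -> torus_op c A x != 0.
  move=> Mx; apply: contra_neq c1 => L0.
  by rewrite -(pdot_normal hc M_sphere M_factor Mx) L0 pdot0l.
split=> [[harm nmin]|[cmk P30]].
  (* The frame at which minimality fails also serves to evaluate the r-tension field. *)
  have [U [eps [e [epsn [eta [oO fr un]]]]]] :
    exists O (eps : 'I_m -> R) e epsn eta,
      [/\ open O, orthonormal_frame t M O eps e, unit_normal t 1 M O epsn eta &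
       exists x, [/\ O x, M x & mean_curvature t 1 eps e epsn eta x <> 0]].
    apply: contrapT => nex; apply: nmin => O eps e epsn eta oO fr un x Ox Mx.
    apply: contrapT => H; apply: nex; exists O, eps, e, epsn, eta; split=> //.
    by exists x.
  move=> [x [Ox Mx mc]].
  have T0 : T != 0.
    have [a _ aE] := mean_curvature_normal hc cardA M_sphere M_factor M_tangent
      oO fr Ox Mx un.
    by apply/eqP => T0; apply: mc; rewrite aE -/T T0 !mulr0.
  split; first by move=> /TP /eqP; rewrite (negbTE T0).
  have /eqP := harm U eps e oO fr x Ox Mx.
  rewrite (tauE _ _ _ oO fr _ Ox Mx) scaler_eq0 (negbTE (normal0 x Mx)) orbF.
  rewrite !mulf_eq0 oppr_eq0 mulf_eq0 invr_eq0 !expf_eq0 /= (negbTE S0).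
  by rewrite (negbTE c1) (negbTE T0) andbF /= => /eqP.
split=> [U eps e oO fr x Ox Mx|minM].
  by rewrite (tauE _ _ _ oO fr _ Ox Mx) P30 mulr0 scale0r.
apply: cmk; apply/TP.
(* Minimality is an assertion about all frames and normals, so one of each must be exhibited before
   it yields [T = 0]. *)
have i1 : (t + (k - l) < m.+2)%N by lia.
pose a0 := Ordinal i1; pose b0 : 'I_m.+2 := ord_max.
have Aa0 : A a0 by rewrite /A /torus_index /=; lia.
have Ab0 : ~~ A b0 by rewrite /A /torus_index /=; lia.
have ta0 : (t <= a0)%N by rewrite /=; lia.
have tb0 : (t <= b0)%N by rewrite /=; lia.
have [U [eps [e [oO Ox fr]]]] :=
  exists_orthonormal_frame hc M_sphere M_factor M_tangent Aa0 Ab0 ta0 tb0 Mx0.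
(* Normalises [L x], of square [c - 1 > 0]; the unit normal is therefore space-like. *)
pose nu := (Num.sqrt (c - 1))^-1.
have nu2 : nu * nu = (c - 1)^-1.
  by rewrite -invfM -expr2 sqr_sqrtr// subr_ge0 ltW.
have un : unit_normal t 1 M U 1 (fun x => nu *: torus_op c A x).
  split; first by left.
    apply: (smoothV_on oO); apply: smoothVZ => //; first exact: smoothR_cst.
    exact: smoothV_normal.
  move=> x Ox' Mx; split.
  - apply: tangent_pseudosphere; first exact: M_sphere.
    by rewrite pdotZl (pdot_normal_pos hc M_sphere M_factor Mx) mulr0.
  - move=> v /(tangentP hc M_tangent _ Mx)[_ v0].
    by rewrite pdotZl pdotC v0 mulr0.
  - rewrite pdotZl pdotZr mulrA nu2 (pdot_normal hc M_sphere M_factor Mx).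
    by rewrite mulVf.
have [a a0' aE] := mean_curvature_normal hc cardA M_sphere M_factor M_tangent
  oO fr Ox Mx0 un.
have /eqP := minM U eps e 1 _ oO fr un x0 Ox Mx0.
rewrite aE !mulf_eq0 invr_eq0 (negbTE m0) (negbTE a0') /= => /eqP //.
Qed.
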